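(* Let $k$ be a positive integer and let $z\in\mathbb{C}$ with $\Re(z)\ge 0$, $z\ne 0$, and $k\le |z|$. Then $$\left|\frac{\widehat{R}_{k+1}(z)}{\widehat{T}_k(z)}\right| < \eta_k\,\frac{(k/|z|)^2}{\pi^2-1}$$ and $$\left|\frac{\widehat{R}_{k}(z)}{\widehat{T}_k(z)}\right| < 1 + \eta_k\,\frac{(k/|z|)^2}{\pi^2-1}.$$
   Context: $\log$ is the principal branch of the logarithm on $\mathbb{C}\setminus(-\infty,0]$. $\ln\Gamma$ denotes the analytic function on $\mathbb{C}\setminus(-\infty,0]$ with $\exp(\ln\Gamma(z))=\Gamma(z)$ that is real and equal to $\log(\Gamma(x))$ for real $x>0$. $B_{2j}(u)$ is the Bernoulli polynomial and $B_{2j}=B_{2j}(0)$ the Bernoulli number. For integers $k\ge1$, $\eta_k = 1/(1-2^{1-2k})$. For integers $j\ge 1$, $$\widehat{T}_j(z) = \frac{B_{2j}(\frac12)}{2j(2j-1)z^{2j-1}} = -\frac{(1-2^{1-2j})B_{2j}}{2j(2j-1)z^{2j-1}},$$ and for integers $k\ge 1$ the remainder $\widehat{R}_k(z)$ is defined by $$\ln\Gamma(z+\tfrac12) = z\log z - z + \tfrac12\log(2\pi) + \sum_{j=1}^{k-1}\widehat{T}_j(z) + \widehat{R}_k(z).$$ *)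

(* Defs.v *)
From Stdlib Require Import Reals Lra Lia Psatz ZArith Arith.
From Coquelicot Require Import Coquelicot.
Open Scope R_scope.

(** ** Bernoulli numbers and polynomials *)

(* [bernoulli_table n] lists B_0, ..., B_n, by the recurrence
   B_(n+1) = - 1/(n+2) * sum_(i <= n) binom(n+2, i) B_i;
   its values beyond index [n] are irrelevant. *)
Fixpoint bernoulli_table (n : nat) : nat -> R :=
  match n with
  | O => fun _ => 1
  | S p => fun m =>
      if (m <=? p)%nat then bernoulli_table p m
      else - sum_f_R0 (fun i => Binomial.C (p + 2) i * bernoulli_table p i) p
             / INR (p + 2)
  end.

Definition bernoulli (n : nat) : R := bernoulli_table n n.

Definition bernoulli_poly (n : nat) (u : R) : R :=
  sum_f_R0 (fun i => Binomial.C n i * bernoulli i * u ^ (n - i)) n.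

Lemma bernoulli_table_val n m : (m <= n)%nat -> bernoulli_table n m = bernoulli m.
Proof.
induction n as [|n IH]; intros Hm.
- replace m with 0%nat by lia. reflexivity.
- destruct (Nat.eq_dec m (S n)) as [->|Hne]; [reflexivity|].
  simpl. rewrite (proj2 (Nat.leb_le m n)) by lia. apply IH. lia.
Qed.

Lemma bernoulli_0 : bernoulli 0 = 1.
Proof. reflexivity. Qed.

Lemma bernoulli_rec n :
  sum_f_R0 (fun i => Binomial.C (S (S n)) i * bernoulli i) (S n) = 0.
Proof.
rewrite tech5.
assert (HC : Binomial.C (S (S n)) (S n) = INR (n + 2)).
{ rewrite pascal_step1 by lia. replace (S (S n) - S n)%nat with 1%nat by lia.
  unfold Binomial.C. replace (S (S n) - 1)%nat with (S n) by lia.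
  rewrite (fact_simpl (S n)), mult_INR.
  replace (n + 2)%nat with (S (S n)) by lia.
  simpl (INR (fact 1)). field. apply INR_fact_neq_0. }
rewrite HC.
replace (bernoulli (S n)) with
  (- sum_f_R0 (fun i => Binomial.C (S (S n)) i * bernoulli i) n / INR (n + 2)).
- field. apply not_0_INR. lia.
- unfold bernoulli at 2. cbn [bernoulli_table].
  rewrite (proj2 (Nat.leb_gt (S n) n)) by lia.
  f_equal. f_equal. apply sum_eq. intros i Hi.
  replace (n + 2)%nat with (S (S n)) by lia.
  rewrite bernoulli_table_val by lia. reflexivity.
Qed.

(** ** Complex exponential and principal logarithm *)

Definition Cexp (z : C) : C :=
  (exp (Re z) * cos (Im z), exp (Re z) * sin (Im z)).

(* The slit plane: complement of the closed half-line (-oo, 0]. *)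
Definition slit_plane (z : C) : Prop := 0 < Re z \/ Im z <> 0.

(* Half-angle formula for the principal argument, valid on [slit_plane]
   only; see [Clog_spec]. *)
Definition Carg (z : C) : R := 2 * atan (Im z / (Cmod z + Re z)).

Definition Clog (z : C) : C := (ln (Cmod z), Carg z).

Lemma slit_plane_Cmod_Re z : slit_plane z -> 0 < Cmod z + Re z.
Proof.
intros Hz. destruct z as [x y]. unfold slit_plane, Re, Im in *. simpl in *.
pose proof (Cmod_ge_0 (x, y)) as H0.
pose proof (Cmod2_alt (x, y)) as H2. unfold Re, Im in H2; simpl in H2.
destruct Hz as [Hx|Hy]; [lra|].
assert (0 < y * y) by nra.
destruct (Rle_or_lt 0 x); nra.
Qed.

Lemma slit_plane_Cmod z : slit_plane z -> 0 < Cmod z.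
Proof.
intros Hz. pose proof (slit_plane_Cmod_Re z Hz).
pose proof (re_le_Cmod z). pose proof (Rle_abs (Re z)). lra.
Qed.

(* On the slit plane [Clog] is the principal branch: the inverse of [Cexp]
   with imaginary part in (-pi, pi). *)
Lemma Clog_spec z :
  slit_plane z -> Cexp (Clog z) = z /\ - PI < Im (Clog z) < PI.
Proof.
intros Hz.
pose proof (slit_plane_Cmod_Re z Hz) as Hs.
pose proof (slit_plane_Cmod z Hz) as Hr.
pose proof (Cmod2_alt z) as H2.
split.
- change (Cexp (Clog z)) with
    (exp (ln (Cmod z)) * cos (Carg z), exp (ln (Cmod z)) * sin (Carg z)).
  rewrite exp_ln by exact Hr. unfold Carg.
  set (t := Im z / (Cmod z + Re z)).
  assert (Ht : 0 < 1 + t * t) by nra.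
  assert (Hsq : sqrt (1 + t²) * sqrt (1 + t²) = 1 + t * t).
  { rewrite sqrt_sqrt; unfold Rsqr; lra. }
  assert (Hs0 : sqrt (1 + t²) <> 0) by (intros E; rewrite E in Hsq; lra).
  assert (Hc : cos (2 * atan t) = (1 - t * t) / (1 + t * t)).
  { rewrite cos_2a, cos_atan, sin_atan, <- Hsq. 
    replace (1 - t * t) with (1 * 1 - t * t) by ring. field. exact Hs0. }
  assert (Hn : sin (2 * atan t) = 2 * t / (1 + t * t)).
  { rewrite sin_2a, cos_atan, sin_atan, <- Hsq. field. exact Hs0. }
  rewrite Hc, Hn. unfold t in *.
  assert (Hd : 1 + Im z / (Cmod z + Re z) * (Im z / (Cmod z + Re z))
               = 2 * Cmod z / (Cmod z + Re z)).
  { apply Rmult_eq_reg_r with ((Cmod z + Re z) * (Cmod z + Re z)); [|nra].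
    field_simplify; [|lra|lra]. nra. }
  rewrite Hd. destruct z as [x y].
  unfold Re, Im in *; cbn [fst snd] in *. 
  set (r := Cmod (x, y)) in *.
  f_equal.
  + replace (1 - y / (r + x) * (y / (r + x))) with (2 * x / (r + x)).
    * field. split; lra.
    * transitivity (2 - 2 * r / (r + x)); [field; lra | rewrite <- Hd; ring].
  + field. split; lra.
- change (Im (Clog z)) with (Carg z). unfold Carg.
  pose proof (atan_bound (Im z / (Cmod z + Re z))). lra.
Qed.

(** ** The Gamma function and its logarithm *)

(* z (z+1) ... (z+n-1) *)
Fixpoint rising_factorial (z : C) (n : nat) : C :=
  match n with
  | O => RtoC 1
  | S p => (rising_factorial z p * (z + RtoC (INR p)))%C
  end.

(* n! n^z / (z (z+1) ... (z+n)) *)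
Definition Gauss_Gamma_seq (z : C) (n : nat) : C :=
  (RtoC (INR (fact n)) * Cexp (z * RtoC (ln (INR n)))
   / rising_factorial z (S n))%C.

(* Gauss's limit; it converges for every z other than 0, -1, -2, ... *)
Definition CGamma (z : C) : C :=
  (real (Lim_seq (fun n => Re (Gauss_Gamma_seq z n))),
   real (Lim_seq (fun n => Im (Gauss_Gamma_seq z n)))).

(* [f] is the branch of ln Gamma on the slit plane; these conditions determine
   its values there uniquely. Differentiability is over the field C. *)
Definition is_lnGamma (f : C -> C) : Prop :=
  (forall z : C, slit_plane z ->
     @ex_derive C_AbsRing C_NormedModule f z) /\
  (forall z : C, slit_plane z -> Cexp (f z) = CGamma z) /\
  (forall x : R, 0 < x -> f (RtoC x) = RtoC (ln (Re (CGamma (RtoC x))))).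

(** ** The asymptotic expansion of ln Gamma (z + 1/2) *)

Definition eta (k : nat) : R := 1 / (1 - powerRZ 2 (1 - 2 * Z.of_nat k)).

(* Meaningful for 1 <= j. *)
Definition T_hat (j : nat) (z : C) : C :=
  (RtoC (bernoulli_poly (2 * j) (1 / 2))
   / (RtoC (2 * INR j * (2 * INR j - 1)) * z ^ (2 * j - 1)))%C.

(* Meaningful for 1 <= k; the sum, over 1 <= j <= k - 1, is empty for k = 1. *)
Definition R_hat (lnGamma : C -> C) (k : nat) (z : C) : C :=
  (lnGamma (z + RtoC (1 / 2))
   - (z * Clog z - z + RtoC (1 / 2 * ln (2 * PI))
      + sum_n_m (fun j => T_hat j z) 1 (k - 1)))%C.

(* Main.v *)
Require Import Defs.
From Stdlib Require Import Reals Lra Lia Arith Machin.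
From Coquelicot Require Import Coquelicot.
Open Scope R_scope.

(** Gauss's product for Gamma (z + 1/2) contains the sum of the logarithms
    Log (z + j + 1/2), a midpoint sum. Euler-Maclaurin summation compares it with
    w Log w - w + T_1(w) + ... + T_m(w) taken between w = z and w = z + n
    ([midpoint_step], [euler_remainder_increment]). Letting n grow, and using
    Stirling's formula for the constant, R_(m+1)(z) is the limit of the
    accumulated error ([log_gauss_limit], [lnGamma_log_gauss]). That error is
    governed by the periodic Bernoulli polynomial B_(2m) against
    (2m-1)! / (z+u)^(2m), and |z+u|^2 >= |z|^2 + u^2 because Re z >= 0. So
    |R_(m+1)| is at most |T_m| times a factor of order sqrt m ([R_hat_bound]).

    For m = k this factor is too large. Instead
    R_(k+1) = T_(k+1) + ... + T_m + R_(m+1) with m well beyond k. The ratio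
    |T_(j+1) / T_j| is about j (j - 1/2) / (pi |z|)^2; as k <= |z|, it starts
    near (k/|z|)^2 / pi^2 and stays small until j approaches pi k, so the terms
    have decayed far enough to absorb the factor sqrt m. A geometric series of
    ratio 1/pi^2 has the sum 1/(pi^2 - 1) of the statement. The ratios grow slowly
    with j, which costs a relative error of order 1/k; the factor
    1 - 1/(2k) of the first ratio pays for it ([tail_bound]).

    The ratio of consecutive T_j is controlled through the Fourier expansion of
    B_(2j)(1/2), which up to sign is 2 (2j)! / (2 pi)^(2j) times
    1 - 4^(-j) + 9^(-j) - ...; that alternating sum lies in [1 - 4^(-j), 1]
    ([bern_half_fourier]). Bounding T_j from above by the first term for j > k, and
    T_k from below by the first two terms, loses a factor 1 / (1 - 4^(-k)), which
    eta_k outweighs.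

    Finally ln Gamma is only known through its exponential and its values on the
    positive axis. It differs from the limit of the logarithms of Gauss's
    quotients by a multiple of 2 pi i, and the crude estimate of R_1 shows that this
    multiple cannot change along a path from |z| to z on which |w| >= 1/2.

    No integral is taken: each estimate compares the increments of two explicit
    antiderivatives. *)

(** * Mean value estimates *)

Lemma MVT_segment (f df : R -> R) (a b : R) :
  a < b -> (forall c, a <= c <= b -> is_derive f c (df c)) ->
  exists c, a < c < b /\ f b - f a = df c * (b - a).
Proof.
intros Hab Hd.
destruct (MVT_cor2 f df a b Hab) as [c [E Hc]].
- intros c Hc. apply is_derive_Reals, Hd, Hc.
- exists c. split; assumption.
Qed.

Lemma derive_nonneg_le (f df : R -> R) (a b : R) :
  a <= b -> (forall c, a <= c <= b -> is_derive f c (df c)) ->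
  (forall c, a <= c <= b -> 0 <= df c) -> f a <= f b.
Proof.
intros Hab Hd Hp. destruct Hab as [Hab| ->]; [|lra].
destruct (MVT_segment f df a b Hab Hd) as [c [Hc E]].
assert (0 <= df c) by (apply Hp; lra).
assert (0 <= df c * (b - a)) by (apply Rmult_le_pos; lra). lra.
Qed.

Lemma derive_zero_const (f : R -> R) :
  (forall x, is_derive f x 0) -> forall x, f x = f 0.
Proof.
intros Hd x.
destruct (Rle_or_lt 0 x).
- apply Rle_antisym.
  + apply Ropp_le_cancel.
    apply (derive_nonneg_le (fun y => - f y) (fun _ => - 0) 0 x); auto.
    * intros c _. apply @is_derive_opp. apply Hd.
    * intros; lra.
  + apply (derive_nonneg_le f (fun _ => 0) 0 x); auto. intros; lra.
- apply Rle_antisym.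
  + apply (derive_nonneg_le f (fun _ => 0) x 0); auto; intros; lra.
  + apply Ropp_le_cancel.
    apply (derive_nonneg_le (fun y => - f y) (fun _ => - 0) x 0); auto.
    * lra.
    * intros c _. apply @is_derive_opp. apply Hd.
    * intros; lra.
Qed.

Lemma derive_bound_increment (f df g dg : R -> R) (a b : R) :
  a <= b ->
  (forall c, a <= c <= b -> is_derive f c (df c)) ->
  (forall c, a <= c <= b -> is_derive g c (dg c)) ->
  (forall c, a <= c <= b -> Rabs (df c) <= dg c) ->
  Rabs (f b - f a) <= g b - g a.
Proof.
intros Hab Hf Hg Hb. apply Rabs_le. split.
- cut (f a + g a <= f b + g b); [lra|].
  apply (derive_nonneg_le (fun t => f t + g t) (fun t => df t + dg t)); trivial.
  + intros c Hc. apply @is_derive_plus; [apply Hf|apply Hg]; exact Hc.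
  + intros c Hc. pose proof (Hb c Hc) as H. apply Rabs_le_between in H. lra.
- cut (g a - f a <= g b - f b); [lra|].
  apply (derive_nonneg_le (fun t => g t - f t) (fun t => dg t - df t)); trivial.
  + intros c Hc. apply @is_derive_minus; [apply Hg|apply Hf]; exact Hc.
  + intros c Hc. pose proof (Hb c Hc) as H. apply Rabs_le_between in H. lra.
Qed.

(** * Bernoulli polynomials *)

(** Division by [n!] makes each polynomial an antiderivative of the previous one. *)
Definition bern (n : nat) (x : R) : R := bernoulli_poly n x / INR (fact n).

Lemma bern_sum n x :
  bern n x = sum_f_R0 (fun i => bernoulli i / INR (fact i)
                                * (x ^ (n - i) / INR (fact (n - i)))) n.
Proof.
unfold bern, bernoulli_poly, Rdiv at 1. rewrite Rmult_comm, scal_sum.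
apply sum_eq. intros i Hi. unfold Binomial.C.
field. repeat split; apply INR_fact_neq_0.
Qed.

Lemma is_derive_bern n x : is_derive (bern (S n)) x (bern n x).
Proof.
eapply is_derive_ext; [intros t; symmetry; apply bern_sum|].
rewrite bern_sum, <- sum_n_Reals.
apply is_derive_ext with
  (fun t => sum_n (fun i => bernoulli i / INR (fact i)
     * (t ^ (S n - i) / INR (fact (S n - i)))) n + bernoulli (S n) / INR (fact (S n))).
- intros t. rewrite sum_n_Reals, tech5, Nat.sub_diag. simpl (INR (fact 0)).
  simpl (t ^ 0). f_equal. now field; apply INR_fact_neq_0.
- rewrite <- (Rplus_0_r (sum_n _ _)).
  apply @is_derive_plus; [|apply @is_derive_const].
  apply (is_derive_sum_n (V := R_NormedModule)). intros i Hi.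
  replace (S n - i)%nat with (S (n - i)) by lia.
  rewrite fact_simpl, mult_INR. auto_derive; [trivial|].
  change (match (n - i)%nat with O => 1 | S _ => INR (n - i) + 1 end)
    with (INR (S (n - i))).
  field. repeat split; try apply INR_fact_neq_0. now apply not_0_INR.
Qed.

Lemma bern_0 x : bern 0 x = 1.
Proof. unfold bern, bernoulli_poly, Binomial.C. simpl. rewrite bernoulli_0. field. Qed.

Lemma bern_1 x : bern 1 x = x - 1 / 2.
Proof.
assert (E : bernoulli 1 = - (1 / 2)).
{ pose proof (bernoulli_rec 0) as H. simpl in H. rewrite bernoulli_0 in H.
  unfold Binomial.C in H. simpl in H. lra. }
unfold bern, bernoulli_poly, Binomial.C. simpl. rewrite bernoulli_0, E. field.
Qed.

Lemma bern_periodic n : bern (S (S n)) 1 = bern (S (S n)) 0.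
Proof.
assert (E : bern (S (S n)) 1 * INR (fact (S (S n)))
            = bern (S (S n)) 0 * INR (fact (S (S n)))).
2:{ apply Rmult_eq_reg_r in E; [exact E|apply INR_fact_neq_0]. }
unfold bern, Rdiv. rewrite !Rmult_assoc, Rinv_l by apply INR_fact_neq_0.
rewrite !Rmult_1_r. unfold bernoulli_poly.
rewrite !(tech5 _ (S n)), Nat.sub_diag, !pow_O. f_equal.
transitivity 0; [rewrite <- (bernoulli_rec n)|symmetry].
- apply sum_eq. intros i Hi. rewrite pow1. ring.
- apply sum_eq_R0. intros i Hi. rewrite pow_i by lia. ring.
Qed.

(** A chain of successive antiderivatives with [p_(n+1)(1) = p_(n+1)(0)] is
    determined by its first member (here 0): periodicity of [p_(n+2)] makes the mean of
    [p_(n+1)] vanish, which fixes the constant of integration. Both functional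
    equations below are instances. The factor [c] accommodates a rescaled
    variable. *)
Lemma appell_chain_zero (p : nat -> R -> R) (c : R) :
  (forall n x, is_derive (p (S n)) x (c * p n x)) ->
  c <> 0 ->
  (forall x, p 0%nat x = 0) ->
  (forall n, p (S n) 1 = p (S n) 0) ->
  forall n x, p n x = 0.
Proof.
intros Hd Hc H0 Hp.
induction n as [|n IH]; [exact H0|].
assert (Hk : forall x, p (S n) x = p (S n) 0).
{ apply derive_zero_const. intros x. generalize (Hd n x). rewrite IH, Rmult_0_r. auto. }
destruct (MVT_segment (p (S (S n))) (fun x => c * p (S n) x) 0 1) as [t [Ht E]].
- lra.
- intros; apply Hd.
- rewrite Hp, Hk in E. intros x. rewrite Hk.
  apply Rmult_eq_reg_l with c; [lra|exact Hc].
Qed.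

Lemma bern_reflect n x : bern n (1 - x) = (-1) ^ n * bern n x.
Proof.
enough (bern n (1 - x) - (-1) ^ n * bern n x = 0) by lra.
apply (appell_chain_zero (fun n x => bern n (1 - x) - (-1) ^ n * bern n x) (-1)).
- clear. intros n x.
  evar_last.
  + apply @is_derive_minus.
    * apply (is_derive_comp (bern (S n)) (fun x => 1 - x)); [apply is_derive_bern|].
      auto_derive; [trivial|reflexivity].
    * apply is_derive_scal, is_derive_bern.
  + unfold minus, plus, opp, scal; simpl. unfold mult; simpl. ring.
- lra.
- intros. rewrite !bern_0. simpl. lra.
- intros [|m].
  + rewrite !bern_1. lra.
  + replace (1 - 1) with 0 by ring. replace (1 - 0) with 1 by ring.
    rewrite bern_periodic. ring.
Qed.

Lemma bern_duplication n x :
  bern n (x / 2) + bern n ((x + 1) / 2) = 2 * (1 / 2) ^ n * bern n x.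
Proof.
enough (2 ^ n * (bern n (x / 2) + bern n ((x + 1) / 2)) - 2 * bern n x = 0) as E.
{ assert (H2 : 2 ^ n * (1 / 2) ^ n = 1).
  { rewrite <- Rpow_mult_distr. replace (2 * (1 / 2)) with 1 by field. apply pow1. }
  transitivity (2 ^ n * (1 / 2) ^ n * (bern n (x / 2) + bern n ((x + 1) / 2))).
  - rewrite H2; ring.
  - rewrite (Rmult_comm (2 ^ n)), Rmult_assoc.
    replace (2 ^ n * (bern n (x / 2) + bern n ((x + 1) / 2))) with (2 * bern n x) by lra.
    ring. }
(* scaled by 2^n so that the members are antiderivatives of one another *)
apply (appell_chain_zero
  (fun n x => 2 ^ n * (bern n (x / 2) + bern n ((x + 1) / 2)) - 2 * bern n x) 1).
- clear. intros n x.
  evar_last.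
  + apply @is_derive_minus.
    * apply is_derive_scal, @is_derive_plus.
      -- apply (is_derive_comp (bern (S n)) (fun x => x / 2)); [apply is_derive_bern|].
         auto_derive; [trivial|reflexivity].
      -- apply (is_derive_comp (bern (S n)) (fun x => (x + 1) / 2));
           [apply is_derive_bern|].
         auto_derive; [trivial|reflexivity].
    * apply is_derive_scal, is_derive_bern.
  + unfold minus, plus, opp, scal; simpl. unfold mult; simpl. field.
- lra.
- intros. rewrite !bern_0. simpl. lra.
- intros [|m].
  + rewrite !bern_1. simpl. lra.
  + replace ((0 + 1) / 2) with (1 / 2) by field. replace (0 / 2) with 0 by field.
    replace ((1 + 1) / 2) with 1 by field. rewrite bern_periodic. ring.
Qed.

Lemma pow_m1_odd m : (-1) ^ S (2 * m) = -1.
Proof. exact (pow_1_odd m). Qed.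

Lemma bern_odd_half m : bern (S (2 * m)) (1 / 2) = 0.
Proof.
pose proof (bern_reflect (S (2 * m)) (1 / 2)) as E.
rewrite pow_m1_odd in E. replace (1 - 1 / 2) with (1 / 2) in E by field. lra.
Qed.

Lemma bern_odd_0 m : bern (S (2 * S m)) 0 = 0.
Proof.
pose proof (bern_reflect (S (2 * S m)) 0) as E.
rewrite pow_m1_odd in E. replace (1 - 0) with 1 in E by ring.
replace (S (2 * S m)) with (S (S (S (2 * m)))) in * by lia.
rewrite bern_periodic in E. lra.
Qed.

(** On [[0, 1/2]] the derivative of the odd polynomial is monotone while the
    polynomial vanishes at both ends, so it has constant sign there, and the next
    even polynomial is monotone. The sign alternates with [m]. *)
Lemma bern_even_monotone m x y :
  (1 <= m)%nat -> 0 <= x -> x <= y -> y <= 1 / 2 ->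
  (-1) ^ m * bern (2 * m) x <= (-1) ^ m * bern (2 * m) y.
Proof.
intros Hm. revert x y.
induction Hm as [|m Hm IH]; intros x y Hx Hxy Hy.
- apply (derive_nonneg_le (fun t => (-1) ^ 1 * bern (2 * 1) t)
     (fun t => (-1) ^ 1 * bern 1 t)); trivial.
  + intros c Hc. apply is_derive_scal, (is_derive_bern 1).
  + intros c Hc. rewrite bern_1. simpl. lra.
- apply (derive_nonneg_le (fun t => (-1) ^ S m * bern (2 * S m) t)
     (fun t => (-1) ^ S m * bern (S (2 * m)) t)); trivial.
  + intros c Hc. apply is_derive_scal.
    replace (2 * S m)%nat with (S (S (2 * m))) by lia. apply is_derive_bern.
  + intros c Hc. cbv beta.
    assert (H0 : bern (S (2 * m)) 0 = 0)
      by (destruct m; [lia|apply bern_odd_0]).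
    pose proof (bern_odd_half m) as H1.
    assert (Hd : forall t : R, is_derive (fun t : R => (-1) ^ m * bern (S (2 * m)) t) t
                    ((-1) ^ m * bern (2 * m) t))
      by (intros; apply is_derive_scal, is_derive_bern).
    destruct (Rle_lt_or_eq_dec 0 c) as [Hc0|<-]; [lra| |rewrite H0; lra].
    destruct (Rle_lt_or_eq_dec c (1 / 2)) as [Hc1| ->]; [lra| |rewrite H1; lra].
    destruct (MVT_segment _ _ 0 c ltac:(lra) (fun t _ => Hd t)) as [s [Hs Es]].
    destruct (MVT_segment _ _ c (1 / 2) ltac:(lra) (fun t _ => Hd t)) as [u [Hu Eu]].
    rewrite H0 in Es. rewrite H1 in Eu.
    assert (Hsu := IH s u ltac:(lra) ltac:(lra) ltac:(lra)).
    set (v := (-1) ^ m * bern (S (2 * m)) c) in *.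
    set (p := (-1) ^ m * bern (2 * m) s) in *.
    set (q := (-1) ^ m * bern (2 * m) u) in *.
    replace ((-1) ^ S m * bern (S (2 * m)) c) with (- v) by (unfold v; simpl pow; ring).
    cut (v <= 0); [lra|].
    apply Rnot_lt_le. intros Hv.
    assert (0 < p) by nra. assert (q < 0) by nra. lra.
Qed.

Lemma pow_half_le m : (1 <= m)%nat -> 0 < 2 * (1 / 4) ^ m <= 1 / 2.
Proof.
intros Hm. split.
- apply Rmult_lt_0_compat; [lra|]. apply pow_lt; lra.
- induction Hm; simpl; [lra|]. simpl in IHHm. lra.
Qed.

Lemma eta_pow m : (1 <= m)%nat -> eta m = 1 / (1 - 2 * (1 / 4) ^ m).
Proof.
intros Hm. unfold eta. do 2 f_equal. unfold Z.sub.
rewrite powerRZ_add by lra. f_equal; [apply powerRZ_1|].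
replace (2 * Z.of_nat m)%Z with (Z.of_nat (2 * m)) by lia.
rewrite powerRZ_neg', <- pow_powerRZ, pow_mult, <- pow_inv. f_equal. lra.
Qed.

Lemma bern_even_0 m : (1 <= m)%nat -> bern (2 * m) 0 = - eta m * bern (2 * m) (1 / 2).
Proof.
intros Hm.
pose proof (bern_duplication (2 * m) 0) as E.
replace ((0 + 1) / 2) with (1 / 2) in E by field.
replace (0 / 2) with 0 in E by field.
rewrite pow_mult in E. replace ((1 / 2) ^ 2) with (1 / 4) in E by field.
rewrite eta_pow by exact Hm. pose proof (pow_half_le m Hm).
set (q := 2 * (1 / 4) ^ m) in *.
replace (bern (2 * m) (1 / 2)) with (- (1 - q) * bern (2 * m) 0) by lra.
field. lra.
Qed.

Lemma eta_ge_1 m : (1 <= m)%nat -> 1 <= eta m.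
Proof.
intros Hm. rewrite eta_pow by exact Hm. pose proof (pow_half_le m Hm).
apply Rle_div_r; lra.
Qed.

Lemma Rabs_pow_m1_mult m x : Rabs ((-1) ^ m * x) = Rabs x.
Proof. rewrite Rabs_mult, pow_1_abs. ring. Qed.

(** By monotonicity the extreme values are those at 0 and 1/2, and by duplication
    the first exceeds the second in absolute value by the factor [eta m]. *)
Lemma bern_even_bound m x :
  (1 <= m)%nat -> 0 <= x <= 1 ->
  Rabs (bern (2 * m) x) <= eta m * Rabs (bern (2 * m) (1 / 2)).
Proof.
intros Hm.
assert (Hhalf : forall x, 0 <= x <= 1 / 2 ->
  Rabs (bern (2 * m) x) <= eta m * Rabs (bern (2 * m) (1 / 2))).
{ clear x. intros x Hx.
  pose proof (bern_even_monotone m 0 x Hm ltac:(lra) ltac:(lra) ltac:(lra)) as H1.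
  pose proof (bern_even_monotone m x (1 / 2) Hm ltac:(lra) ltac:(lra) ltac:(lra)) as H2.
  rewrite bern_even_0 in H1 by exact Hm.
  pose proof (eta_ge_1 m Hm) as He.
  rewrite <- (Rabs_pow_m1_mult m (bern (2 * m) x)),
    <- (Rabs_pow_m1_mult m (bern (2 * m) (1 / 2))).
  set (h := (-1) ^ m * bern (2 * m) (1 / 2)) in *.
  replace ((-1) ^ m * (- eta m * bern (2 * m) (1 / 2))) with (- (eta m * h)) in H1
    by (unfold h; ring).
  assert (0 <= h) by nra.
  rewrite (Rabs_pos_eq h) by lra. apply Rabs_le. nra. }
intros Hx. destruct (Rle_or_lt x (1 / 2)) as [H|H].
- apply Hhalf; lra.
- replace (bern (2 * m) x) with (bern (2 * m) (1 - x)).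
  + apply Hhalf; lra.
  + rewrite bern_reflect, pow_1_even. ring.
Qed.

(** * Fourier expansion of the even Bernoulli polynomials at 1/2 *)

Lemma is_derive_bern_shift n a u :
  is_derive (fun t => bern (S n) (a + t)) u (bern n (a + u)).
Proof.
evar_last.
- apply (is_derive_comp (bern (S n)) (fun t => a + t)); [apply is_derive_bern|].
  auto_derive; [trivial|reflexivity].
- unfold scal; simpl; unfold mult; simpl. ring.
Qed.

Lemma cos_pi_nat n : cos (PI * INR n) = (-1) ^ n.
Proof.
induction n as [|n IH]; [now rewrite Rmult_0_r, cos_0|].
rewrite S_INR, Rmult_plus_distr_l, Rmult_1_r, neg_cos, IH. simpl. ring.
Qed.

Lemma sin_pi_nat n : sin (PI * INR n) = 0.
Proof.
induction n as [|n IH]; [now rewrite Rmult_0_r, sin_0|].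
rewrite S_INR, Rmult_plus_distr_l, Rmult_1_r, neg_sin, IH. ring.
Qed.

(** An antiderivative of [bern (2 j) (1/2 + u) * cos (w u)], obtained by
    integrating by parts twice at each step. *)
Fixpoint bern_cos_prim (w : R) (j : nat) (u : R) : R :=
  match j with
  | O => sin (w * u) / w
  | S i => bern (2 * S i) (1 / 2 + u) * (sin (w * u) / w)
           + bern (S (2 * i)) (1 / 2 + u) * (cos (w * u) / w ^ 2)
           - bern_cos_prim w i u / w ^ 2
  end.

Lemma is_derive_bern_cos_prim w j u :
  w <> 0 ->
  is_derive (bern_cos_prim w j) u (bern (2 * j) (1 / 2 + u) * cos (w * u)).
Proof.
intros Hw. induction j as [|i IH].
- simpl. rewrite bern_0. auto_derive; [trivial|]. field. exact Hw.
- cbn [bern_cos_prim]. replace (2 * S i)%nat with (S (S (2 * i))) by lia.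
  evar_last.
  + apply @is_derive_minus; [apply @is_derive_plus|].
    * apply (is_derive_mult (fun t => bern (S (S (2 * i))) (1 / 2 + t))
                            (fun t => sin (w * t) / w)).
      -- apply is_derive_bern_shift.
      -- auto_derive; [trivial|reflexivity].
      -- intros; apply Rmult_comm.
    * apply (is_derive_mult (fun t => bern (S (2 * i)) (1 / 2 + t))
                            (fun t => cos (w * t) / w ^ 2)).
      -- apply is_derive_bern_shift.
      -- auto_derive; [trivial|reflexivity].
      -- intros; apply Rmult_comm.
    * unfold Rdiv. apply (is_derive_scal_l (V := R_NormedModule) (bern_cos_prim w i)).
      apply IH.
  + unfold minus, plus, opp, scal, mult; simpl; unfold mult; simpl. field. exact Hw.
Qed.

(** The Fourier cosine coefficients: [sin (w u)] vanishes at both ends and the odd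
    polynomials vanish at 1/2 and at 1, except the first one, whose value 1/2 at
    1 starts the induction. *)
Lemma bern_cos_coeff n j :
  (1 <= n)%nat ->
  let w := 2 * PI * INR n in
  bern_cos_prim w (S j) (1 / 2) - bern_cos_prim w (S j) 0
  = (-1) ^ (j + n) / (2 * w ^ (2 * S j)).
Proof.
intros Hn w.
assert (Hw : w <> 0).
{ unfold w. pose proof PI_RGT_0. apply lt_0_INR in Hn.
  apply Rgt_not_eq. apply Rmult_lt_0_compat; lra. }
assert (Hs : sin (w * (1 / 2)) = 0).
{ replace (w * (1 / 2)) with (PI * INR n) by (unfold w; field). apply sin_pi_nat. }
assert (Hc : cos (w * (1 / 2)) = (-1) ^ n).
{ replace (w * (1 / 2)) with (PI * INR n) by (unfold w; field). apply cos_pi_nat. }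
induction j as [|j IH].
- cbn [bern_cos_prim]. change (S (2 * 0)) with 1%nat. rewrite !bern_1, Hs, Hc.
  rewrite Rmult_0_r, sin_0. simpl. field. exact Hw.
- remember (S j) as i eqn:Ei. cbn [bern_cos_prim].
  rewrite Hs, Rmult_0_r, sin_0, Rplus_0_r, bern_odd_half.
  replace (1 / 2 + 1 / 2) with 1 by field.
  replace (bern (S (2 * i)) 1) with 0.
  2:{ subst i. replace (S (2 * S j)) with (S (S (S (2 * j)))) by lia.
      rewrite bern_periodic. replace (S (S (S (2 * j)))) with (S (2 * S j)) by lia.
      now rewrite bern_odd_0. }
  replace (bern_cos_prim w i (1 / 2)) with
    (bern_cos_prim w i 0 + (-1) ^ (j + n) / (2 * w ^ (2 * i))) by lra.
  replace (2 * S i)%nat with (2 * i + 2)%nat by lia. rewrite (pow_add w).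
  replace (i + n)%nat with (S (j + n)) by lia. simpl ((-1) ^ S (j + n)).
  field. split; first [exact Hw|apply pow_nonzero, Hw].
Qed.

(** The Dirichlet kernel and the unnormalised Fejer kernel, the sum of the first
    [n] Dirichlet kernels. *)
Fixpoint dirichlet (n : nat) (u : R) : R :=
  match n with
  | O => 1
  | S m => dirichlet m u + 2 * cos (2 * PI * INR (S m) * u)
  end.

Fixpoint fejer (n : nat) (u : R) : R :=
  match n with
  | O => 0
  | S m => fejer m u + dirichlet m u
  end.

Lemma dirichlet_sin n u :
  sin (PI * u) * dirichlet n u = sin (PI * u + 2 * (PI * INR n * u)).
Proof.
induction n as [|n IH].
- simpl. replace (PI * u + 2 * (PI * 0 * u)) with (PI * u) by ring. ring.
- cbn [dirichlet]. rewrite Rmult_plus_distr_l, IH.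
  set (a := PI * u). set (b := 2 * PI * INR (S n) * u).
  replace (a + 2 * (PI * INR n * u)) with (b - a)
    by (unfold a, b; rewrite S_INR; ring).
  replace (a + 2 * (PI * INR (S n) * u)) with (b + a) by (unfold a, b; ring).
  rewrite sin_plus, sin_minus. ring.
Qed.

Lemma fejer_sin n u : sin (PI * u) ^ 2 * fejer n u = sin (PI * INR n * u) ^ 2.
Proof.
induction n as [|n IH].
- simpl. replace (PI * 0 * u) with 0 by ring. rewrite sin_0. ring.
- cbn [fejer]. rewrite Rmult_plus_distr_l, IH.
  replace (sin (PI * u) ^ 2 * dirichlet n u)
    with (sin (PI * u) * (sin (PI * u) * dirichlet n u)) by ring.
  rewrite dirichlet_sin.
  set (a := PI * u). set (b := PI * INR n * u).
  replace (PI * INR (S n) * u) with (a + b) by (unfold a, b; rewrite S_INR; ring).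
  replace (2 * b) with (b + b) by ring.
  rewrite !sin_plus, cos_plus.
  pose proof (sin2_cos2 a) as Ha. pose proof (sin2_cos2 b) as Hb.
  unfold Rsqr in *.
  assert (Ec : cos a * cos a = 1 - sin a * sin a) by lra.
  assert (Ed : cos b * cos b = 1 - sin b * sin b) by lra.
  ring_simplify.
  replace (cos a ^ 2) with (1 - sin a * sin a) by (rewrite <- Ec; ring).
  replace (cos b ^ 2) with (1 - sin b * sin b) by (rewrite <- Ed; ring).
  ring.
Qed.

Lemma cos_ge_parabola x : 1 - x ^ 2 / 2 <= cos x.
Proof.
replace x with (2 * (x / 2)) at 2 by field.
rewrite cos_2a_sin.
assert (H : Rabs (sin (x / 2)) <= Rabs (x / 2)).
{ destruct (Rtotal_order (x / 2) 0) as [H|[->|H]].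
  - rewrite <- (Rabs_Ropp (sin _)), <- (Rabs_Ropp (x / 2)), <- sin_neg.
    rewrite (Rabs_pos_eq (- (x / 2))) by lra.
    pose proof (sin_lt_x (- (x / 2)) ltac:(lra)).
    pose proof (SIN_bound (- (x / 2))).
    destruct (Rle_or_lt (- (x / 2)) 1).
    + rewrite Rabs_pos_eq; [lra|]. apply sin_ge_0; [lra|]. pose proof PI2_1. lra.
    + apply Rabs_le. lra.
  - rewrite sin_0. lra.
  - rewrite (Rabs_pos_eq (x / 2)) by lra.
    pose proof (sin_lt_x (x / 2) ltac:(lra)).
    pose proof (SIN_bound (x / 2)).
    destruct (Rle_or_lt (x / 2) 1).
    + rewrite Rabs_pos_eq; [lra|]. apply sin_ge_0; [lra|]. pose proof PI2_1. lra.
    + apply Rabs_le. lra. }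
apply Rsqr_le_abs_1 in H. unfold Rsqr in H. nra.
Qed.

Lemma sin_pi_ge u : 0 <= u <= 1 / 2 -> u <= sin (PI * u).
Proof.
intros Hu. pose proof PI2_3_2 as H3. pose proof PI_4 as H4.
assert (H : 0 - (0 - 0 ^ 3 / 6) <= sin (PI * u) - (PI * u - (PI * u) ^ 3 / 6)).
{ rewrite <- sin_0 at 1.
  apply (derive_nonneg_le (fun x => sin x - (x - x ^ 3 / 6))
           (fun x => cos x - (1 - x ^ 2 / 2))).
  - apply Rmult_le_pos; lra.
  - intros c _. auto_derive; [trivial|]. field.
  - intros c _. pose proof (cos_ge_parabola c). lra. }
assert (0 <= PI * u <= 2) by nra.
set (x := PI * u) in *.
assert (x ^ 3 <= 4 * x).
{ assert (x ^ 2 <= 4) by nra. simpl in *. nra. }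
assert (3 * u <= x) by (unfold x; nra). lra.
Qed.

(** Since the bound is uniform in [n], the integral of a function vanishing to
    second order at 0 against [fejer n] stays bounded, and its Fejer mean, which
    involves a division by [n], tends to 0. *)
Lemma fejer_bound n u : 0 <= u <= 1 / 2 -> Rabs (u ^ 2 * fejer n u) <= 1.
Proof.
intros Hu. destruct (proj1 Hu) as [Hp|<-].
2:{ replace (0 ^ 2 * fejer n 0) with 0 by ring. rewrite Rabs_R0. lra. }
pose proof (sin_pi_ge u Hu) as Hs. pose proof (fejer_sin n u) as E.
assert (0 <= sin (PI * INR n * u) ^ 2 <= 1).
{ pose proof (SIN_bound (PI * INR n * u)). nra. }
assert (H2 : 0 < u ^ 2 <= sin (PI * u) ^ 2) by nra.
assert (0 <= fejer n u) by nra.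
rewrite Rabs_pos_eq by (apply Rmult_le_pos; lra). nra.
Qed.

(** The alternating sum, peeled from the front: for decreasing terms its bounds
    then follow by induction. *)
Fixpoint altsum (v : nat -> R) (n : nat) : R :=
  match n with
  | O => 0
  | S m => v O - altsum (fun i => v (S i)) m
  end.

Lemma altsum_last v n : altsum v (S n) = altsum v n + (-1) ^ n * v n.
Proof.
revert v. induction n as [|n IH]; intros v; [simpl; ring|].
change (altsum v (S (S n))) with (v O - altsum (fun i => v (S i)) (S n)).
rewrite IH. simpl. ring.
Qed.

Lemma altsum_bounds v n :
  (forall i, 0 <= v i) -> (forall i, v (S i) <= v i) ->
  0 <= altsum v n <= v O /\ ((1 <= n)%nat -> v O - v 1%nat <= altsum v n).
Proof.
revert v. induction n as [|n IH]; intros v H0 Hd.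
- simpl. pose proof (H0 O). split; [lra|lia].
- destruct (IH (fun i => v (S i))) as [H _]; [auto|auto|].
  simpl. pose proof (Hd O). split; [lra|intros; lra].
Qed.

Definition even_power_inv (j i : nat) : R := / INR (S i) ^ (2 * j).

Lemma altsum_even_power_inv j n :
  altsum (even_power_inv j) n <= 1 /\
  ((1 <= n)%nat -> 1 - (1 / 4) ^ j <= altsum (even_power_inv j) n).
Proof.
destruct (altsum_bounds (even_power_inv j) n) as [[_ H1] H2].
- intros i. apply Rlt_le, Rinv_0_lt_compat, pow_lt, lt_0_INR. lia.
- intros i. apply Rinv_le_contravar.
  + apply pow_lt, lt_0_INR. lia.
  + apply pow_incr. split; [apply pos_INR|apply le_INR; lia].
- unfold even_power_inv in H1, H2 at 1 2. simpl (INR 1) in *. simpl (INR 2) in *.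
  rewrite pow1, Rinv_1 in *. split; [exact H1|]. intros Hn. specialize (H2 Hn).
  rewrite pow_mult, <- pow_inv in H2. replace (/ (1 + 1) ^ 2) with (1 / 4) in H2 by field.
  exact H2.
Qed.

Section FejerMean.

Variable i : nat.
Let j := S i.
Let f0 := bern (2 * j) (1 / 2).

(** Antiderivatives of [bern (2 j) (1/2 + u) - f0] times the two kernels. *)
Fixpoint dirichlet_prim (n : nat) (u : R) : R :=
  match n with
  | O => bern (S (2 * j)) (1 / 2 + u) - f0 * u
  | S m => dirichlet_prim m u
           + 2 * (bern_cos_prim (2 * PI * INR (S m)) j u
                  - f0 * (sin (2 * PI * INR (S m) * u) / (2 * PI * INR (S m))))
  end.

Fixpoint fejer_prim (n : nat) (u : R) : R :=
  match n with
  | O => 0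
  | S m => fejer_prim m u + dirichlet_prim m u
  end.

Lemma two_pi_S_neq_0 m : 2 * PI * INR (S m) <> 0.
Proof.
pose proof PI_RGT_0. pose proof (lt_0_INR (S m) ltac:(lia)).
apply Rgt_not_eq, Rmult_lt_0_compat; lra.
Qed.

Lemma is_derive_dirichlet_prim n u :
  is_derive (dirichlet_prim n) u ((bern (2 * j) (1 / 2 + u) - f0) * dirichlet n u).
Proof.
induction n as [|n IH]; cbn [dirichlet_prim dirichlet].
- rewrite Rmult_1_r. apply @is_derive_minus; [apply is_derive_bern_shift|].
  auto_derive; [trivial|ring].
- rewrite Rmult_plus_distr_l. apply @is_derive_plus; [exact IH|].
  pose proof (two_pi_S_neq_0 n) as Hw.
  set (w := 2 * PI * INR (S n)) in *.
  replace ((bern (2 * j) (1 / 2 + u) - f0) * (2 * cos (w * u)))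
    with (2 * (bern (2 * j) (1 / 2 + u) * cos (w * u) - f0 * cos (w * u))) by ring.
  apply is_derive_scal, @is_derive_minus.
  + apply is_derive_bern_cos_prim. exact Hw.
  + apply is_derive_scal. auto_derive; [trivial|]. field. exact Hw.
Qed.

Lemma is_derive_fejer_prim n u :
  is_derive (fejer_prim n) u ((bern (2 * j) (1 / 2 + u) - f0) * fejer n u).
Proof.
induction n as [|n IH]; cbn [fejer_prim fejer].
- rewrite Rmult_0_r. apply @is_derive_const.
- rewrite Rmult_plus_distr_l. apply @is_derive_plus; [exact IH|].
  apply is_derive_dirichlet_prim.
Qed.

(** The constant term [- f0 / 2] comes from the mean value 0 of [bern (2 j)]. *)
Lemma dirichlet_prim_increment n :
  dirichlet_prim n (1 / 2) - dirichlet_prim n 0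
  = (-1) ^ j / (2 * PI) ^ (2 * j) * altsum (even_power_inv j) n - f0 / 2.
Proof.
pose proof PI_RGT_0 as Hpi.
induction n as [|n IH].
- cbn [dirichlet_prim altsum]. rewrite Rplus_0_r, bern_odd_half.
  replace (1 / 2 + 1 / 2) with 1 by field.
  replace (bern (S (2 * j)) 1) with 0; [field; apply pow_nonzero; lra|].
  unfold j. replace (S (2 * S i)) with (S (S (S (2 * i)))) by lia.
  rewrite bern_periodic. replace (S (S (S (2 * i)))) with (S (2 * S i)) by lia.
  now rewrite bern_odd_0.
- cbn [dirichlet_prim]. rewrite altsum_last.
  pose proof (bern_cos_coeff (S n) i ltac:(lia)) as E. cbv zeta in E.
  fold j in E.
  replace (2 * PI * INR (S n) * (1 / 2)) with (PI * INR (S n)) by field.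
  rewrite sin_pi_nat, Rmult_0_r, sin_0.
  pose proof (two_pi_S_neq_0 n) as Hw.
  rewrite Rpow_mult_distr in E. unfold even_power_inv at 2.
  set (w := 2 * PI * INR (S n)) in *.
  transitivity (dirichlet_prim n (1 / 2) - dirichlet_prim n 0
    + 2 * (bern_cos_prim w j (1 / 2) - bern_cos_prim w j 0)); [field; exact Hw|].
  rewrite IH, E.
  replace (i + S n)%nat with (j + n)%nat by (unfold j; lia). rewrite pow_add.
  field. split; apply pow_nonzero; [apply not_0_INR; lia|lra].
Qed.

(** [bern (2 j)] is even about 1/2, so its derivative vanishes there. *)
Lemma bern_even_quadratic :
  exists K, 0 <= K /\ forall u, 0 <= u <= 1 / 2 ->
    Rabs (bern (2 * j) (1 / 2 + u) - f0) <= K * u ^ 2.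
Proof.
assert (HK : exists K, 0 <= K /\ forall u, 0 <= u <= 1 / 2 ->
          Rabs (bern (2 * i) (1 / 2 + u)) <= K).
{ destruct i as [|p].
  - exists 1. split; [lra|]. intros. rewrite bern_0, Rabs_R1. lra.
  - exists (eta (S p) * Rabs (bern (2 * S p) (1 / 2))). split.
    + apply Rmult_le_pos; [|apply Rabs_pos].
      pose proof (eta_ge_1 (S p) ltac:(lia)). lra.
    + intros u Hu. apply bern_even_bound; [lia|lra]. }
destruct HK as [K [HK0 HK]]. exists K. split; [exact HK0|].
intros u Hu.
assert (H1 : forall t, 0 <= t <= 1 / 2 -> Rabs (bern (S (2 * i)) (1 / 2 + t)) <= K * t).
{ intros t Ht.
  pose proof (derive_bound_increment (fun t => bern (S (2 * i)) (1 / 2 + t))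
    (fun t => bern (2 * i) (1 / 2 + t)) (fun t => K * t) (fun _ => K) 0 t) as H.
  cbv beta in H. rewrite Rplus_0_r, bern_odd_half, Rminus_0_r, Rmult_0_r, Rminus_0_r in H.
  apply H.
  - lra.
  - intros. apply is_derive_bern_shift.
  - intros. auto_derive; [trivial|ring].
  - intros. apply HK. lra. }
pose proof (derive_bound_increment (fun t => bern (2 * j) (1 / 2 + t))
    (fun t => bern (S (2 * i)) (1 / 2 + t)) (fun t => K / 2 * t ^ 2)
    (fun t => K * t) 0 u) as H.
cbv beta in H. rewrite Rplus_0_r in H. fold f0 in H.
apply Rle_trans with (K / 2 * u ^ 2 - K / 2 * 0 ^ 2).
- apply H.
  + lra.
  + intros. unfold j. replace (2 * S i)%nat with (S (S (2 * i))) by lia.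
    apply is_derive_bern_shift.
  + intros. auto_derive; [trivial|field].
  + intros. apply H1. lra.
- pose proof (pow2_ge_0 u). nra.
Qed.

Lemma fejer_prim_bounded :
  exists K, forall n, Rabs (fejer_prim n (1 / 2) - fejer_prim n 0) <= K.
Proof.
destruct bern_even_quadratic as [K [HK0 HK]]. exists (K * (1 / 2) - K * 0).
intros n.
apply (derive_bound_increment (fejer_prim n)
  (fun u => (bern (2 * j) (1 / 2 + u) - f0) * fejer n u) (fun t => K * t) (fun _ => K)).
- lra.
- intros c _. apply is_derive_fejer_prim.
- intros c _. auto_derive; [trivial|ring].
- intros c Hc. rewrite Rabs_mult.
  apply Rle_trans with (K * c ^ 2 * Rabs (fejer n c)).
  + apply Rmult_le_compat_r; [apply Rabs_pos|]. apply HK, Hc.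
  + pose proof (fejer_bound n c Hc) as H. rewrite Rabs_mult in H.
    rewrite (Rabs_pos_eq (c ^ 2)) in H by apply pow2_ge_0. nra.
Qed.

(** The increments of [fejer_prim] are sums of the quantities
    [altsum (even_power_inv j) n - c / 2], where [c] is the middle term below.
    They stay bounded, so [c / 2] is the Cesaro limit of the alternating sums and
    lies between their eventual bounds. *)
Lemma bern_half_fourier :
  2 * (1 - (1 / 4) ^ j) <= (-1) ^ j * (2 * PI) ^ (2 * j) * f0 <= 2.
Proof.
pose proof PI_RGT_0 as Hpi.
assert (Hp : 0 < (2 * PI) ^ (2 * j)) by (apply pow_lt; lra).
set (p := (2 * PI) ^ (2 * j)) in *. set (s := (-1) ^ j).
assert (Hs : s * s = 1).
{ unfold s. rewrite <- pow_add. replace (j + j)%nat with (2 * j)%nat by lia.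
  apply pow_1_even. }
set (c := s * p * f0).
set (d := fun n => s * p * (dirichlet_prim n (1 / 2) - dirichlet_prim n 0)).
set (D := fun n => s * p * (fejer_prim n (1 / 2) - fejer_prim n 0)).
assert (Ed : forall n, d n = altsum (even_power_inv j) n - c / 2).
{ intros n. unfold d. rewrite dirichlet_prim_increment. fold p s. unfold c.
  transitivity (s * s * altsum (even_power_inv j) n - s * p * f0 / 2);
    [field; lra|rewrite Hs; lra]. }
assert (ED : forall n, D (S n) = D n + d n).
{ intros n. unfold D, d. cbn [fejer_prim]. ring. }
assert (D0 : D O = 0) by (unfold D; simpl; ring).
assert (HU : forall n, D n <= INR n * (1 - c / 2)).
{ induction n as [|n IH]; [rewrite D0; simpl; lra|].
  rewrite ED, Ed, S_INR. destruct (altsum_even_power_inv j n). lra. }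
assert (HL : forall n, INR n * (1 - (1 / 4) ^ j - c / 2) - 1 <= D n).
{ induction n as [|n IH]; [rewrite D0; simpl; lra|].
  rewrite ED, Ed, S_INR. destruct (altsum_even_power_inv j n) as [_ H].
  destruct n as [|n].
  - rewrite D0. change (altsum (even_power_inv j) 0) with 0. change (INR 0) with 0.
    assert (0 <= (1 / 4) ^ j) by (apply pow_le; lra). lra.
  - specialize (H ltac:(lia)). lra. }
destruct fejer_prim_bounded as [K HK].
assert (HD : forall n, Rabs (D n) <= p * K).
{ intros n. unfold D. rewrite Rmult_assoc. unfold s. rewrite Rabs_pow_m1_mult.
  rewrite Rabs_mult, (Rabs_pos_eq p) by lra.
  apply Rmult_le_compat_l; [lra|apply HK]. }
(* linear growth would contradict the boundedness of D *)
assert (Harch : forall e B, 0 < e -> exists n, B < INR n * e).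
{ intros e B He. destruct (Rcomplements.nfloor_ex (Rmax 0 (B / e))) as [n [_ Hn]].
  - apply Rmax_l.
  - exists (S n). rewrite S_INR.
    apply Rmult_lt_reg_r with (/ e); [apply Rinv_0_lt_compat; lra|].
    rewrite Rmult_assoc, Rinv_r by lra. rewrite Rmult_1_r.
    apply Rle_lt_trans with (Rmax 0 (B / e)); [apply Rmax_r|exact Hn]. }
split.
- apply Rnot_lt_le. intros H. fold c in H.
  destruct (Harch (1 - (1 / 4) ^ j - c / 2) (1 + p * K) ltac:(lra)) as [n Hn].
  pose proof (HL n) as H1. pose proof (HD n) as H2. apply Rabs_le_between in H2. lra.
- apply Rnot_lt_le. intros H. fold c in H.
  destruct (Harch (c / 2 - 1) (p * K) ltac:(lra)) as [n Hn].
  pose proof (HU n) as H1. pose proof (HD n) as H2. apply Rabs_le_between in H2. lra.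
Qed.

End FejerMean.

Lemma bern_half_abs m :
  (1 <= m)%nat ->
  2 * (1 - (1 / 4) ^ m) / (2 * PI) ^ (2 * m) <= Rabs (bern (2 * m) (1 / 2))
    <= 2 / (2 * PI) ^ (2 * m).
Proof.
intros Hm. destruct m as [|i]; [lia|].
pose proof (bern_half_fourier i) as H. pose proof PI_RGT_0.
assert (Hp : 0 < (2 * PI) ^ (2 * S i)) by (apply pow_lt; lra).
set (p := (2 * PI) ^ (2 * S i)) in *. set (b := bern (2 * S i) (1 / 2)) in *.
assert (Hq : 0 <= 1 - (1 / 4) ^ S i).
{ pose proof (pow_half_le (S i) ltac:(lia)). lra. }
assert (E : (-1) ^ S i * p * b = Rabs b * p).
{ rewrite <- (Rabs_pos_eq ((-1) ^ S i * p * b)) by lra.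
  rewrite Rmult_assoc, Rabs_pow_m1_mult, Rabs_mult, (Rabs_pos_eq p) by lra. ring. }
rewrite E in H. split.
- apply Rle_div_l; [exact Hp|apply H].
- apply Rle_div_r; [exact Hp|apply H].
Qed.

(** * Complex-valued functions of a real variable *)

Definition is_derivC (F : R -> C) (u : R) (D : C) : Prop :=
  is_derive (fun t => Re (F t)) u (Re D) /\ is_derive (fun t => Im (F t)) u (Im D).

Lemma is_derivC_ext F G u D :
  (forall t, F t = G t) -> is_derivC F u D -> is_derivC G u D.
Proof.
intros E [H1 H2]; split.
- apply (is_derive_ext (fun t => Re (F t))); [intros t; now rewrite E|exact H1].
- apply (is_derive_ext (fun t => Im (F t))); [intros t; now rewrite E|exact H2].
Qed.

Lemma is_derivC_const c u : is_derivC (fun _ => c) u 0.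
Proof. split; apply @is_derive_const. Qed.

Lemma is_derivC_real (f : R -> R) (u d : R) :
  is_derive f u d -> is_derivC (fun t => RtoC (f t)) u (RtoC d).
Proof.
intros H. split; [exact H|]. simpl. apply (is_derive_const (V := R_NormedModule)).
Qed.

Lemma is_derivC_plus F G u DF DG :
  is_derivC F u DF -> is_derivC G u DG ->
  is_derivC (fun t => F t + G t)%C u (DF + DG)%C.
Proof. intros [H1 H2] [H3 H4]; split; now apply @is_derive_plus. Qed.

Lemma is_derivC_minus F G u DF DG :
  is_derivC F u DF -> is_derivC G u DG ->
  is_derivC (fun t => F t - G t)%C u (DF - DG)%C.
Proof. intros [H1 H2] [H3 H4]; split; now apply @is_derive_minus. Qed.

Lemma is_derivC_mult F G u DF DG :
  is_derivC F u DF -> is_derivC G u DG ->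
  is_derivC (fun t => F t * G t)%C u (DF * G u + F u * DG)%C.
Proof.
intros [H1 H2] [H3 H4]; split; simpl.
- evar_last.
  + apply @is_derive_minus;
      [apply (is_derive_mult (fun t => Re (F t)) (fun t => Re (G t)))
      |apply (is_derive_mult (fun t => Im (F t)) (fun t => Im (G t)))];
      try eassumption; intros; apply Rmult_comm.
  + unfold minus, plus, opp, mult; simpl. unfold mult, Re, Im; simpl. ring.
- evar_last.
  + apply @is_derive_plus;
      [apply (is_derive_mult (fun t => Re (F t)) (fun t => Im (G t)))
      |apply (is_derive_mult (fun t => Im (F t)) (fun t => Re (G t)))];
      try eassumption; intros; apply Rmult_comm.
  + unfold plus, mult; simpl. unfold mult, Re, Im; simpl. ring.
Qed.

Lemma is_derivC_shift w u : is_derivC (fun t => w + RtoC t)%C u 1.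
Proof.
split; simpl; auto_derive; trivial; ring.
Qed.

Lemma Cmod_rotation (c : C) :
  exists w : C, Cmod w = 1 /\ (w * c)%C = RtoC (Cmod c).
Proof.
destruct (Req_dec (Cmod c) 0) as [H|H].
- exists 1%C. split; [apply Cmod_1|]. apply Cmod_eq_0 in H. subst c.
  rewrite Cmod_0. ring.
- exists (Cconj c / RtoC (Cmod c))%C.
  assert (Hc : RtoC (Cmod c) <> 0%C) by (intros E; apply RtoC_inj in E; lra).
  split.
  + rewrite Cmod_div, Cmod_conj, Cmod_R, Rabs_pos_eq by (trivial; apply Cmod_ge_0).
    field. exact H.
  + replace (Cconj c / RtoC (Cmod c) * c)%C with (c * Cconj c / RtoC (Cmod c))%C
      by (field; exact Hc).
    rewrite <- Cmod2_conj, RtoC_pow. simpl. field. exact Hc.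
Qed.

(** The mean value inequality: rotating the increment onto the positive real axis
    reduces it to a real function. *)
Lemma Cmod_increment_le (F DF : R -> C) (g dg : R -> R) (a b : R) :
  a <= b ->
  (forall u, a <= u <= b -> is_derivC F u (DF u)) ->
  (forall u, a <= u <= b -> is_derive g u (dg u)) ->
  (forall u, a <= u <= b -> Cmod (DF u) <= dg u) ->
  Cmod (F b - F a)%C <= g b - g a.
Proof.
intros Hab HF Hg Hle.
destruct (Cmod_rotation (F b - F a)%C) as [w [Hw E]].
assert (H : Rabs (Re (w * F b)%C - Re (w * F a)%C) <= g b - g a).
{ apply (derive_bound_increment (fun u => Re (w * F u)%C) (fun u => Re (w * DF u)%C) g dg);
    trivial.
  - intros u Hu.
    destruct (is_derivC_mult (fun _ => w) F u 0 (DF u)) as [H _].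
    + apply is_derivC_const.
    + apply HF, Hu.
    + replace (w * DF u)%C with (0 * F u + w * DF u)%C by ring. exact H.
  - intros u Hu. eapply Rle_trans; [apply re_le_Cmod|].
    rewrite Cmod_mult, Hw, Rmult_1_l. apply Hle, Hu. }
replace (Re (w * F b)%C - Re (w * F a)%C) with (Re (w * (F b - F a))%C) in H
  by (simpl; ring).
rewrite E in H. simpl in H. rewrite Rabs_pos_eq in H by apply Cmod_ge_0. exact H.
Qed.

Lemma slit_plane_neq_0 w : slit_plane w -> w <> 0%C.
Proof. intros H. apply Cmod_gt_0, slit_plane_Cmod, H. Qed.

Lemma is_derivC_Clog w u :
  slit_plane (w + RtoC u)%C ->
  is_derivC (fun t => Clog (w + RtoC t)) u (/ (w + RtoC u))%C.
Proof.
intros Hs.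
pose proof (slit_plane_Cmod_Re _ Hs) as H1.
pose proof (slit_plane_Cmod _ Hs) as H2.
destruct w as [x y].
set (v := x + u).
assert (Ev : ((x, y) + RtoC u)%C = (v, y)) by (unfold v, RtoC, Cplus; simpl; f_equal; ring).
rewrite Ev in *. clear Hs.
assert (Er : Cmod (v, y) = sqrt (v * v + y * y))
  by (unfold Cmod; simpl; f_equal; ring).
rewrite Er in *. simpl Re in *.
set (r := sqrt (v * v + y * y)) in *.
assert (Hp : 0 < v * v + y * y).
{ destruct (Rlt_or_le 0 (v * v + y * y)) as [h|h]; [exact h|].
  unfold r in H2. rewrite sqrt_neg_0 in H2; lra. }
assert (Hr : r * r = v * v + y * y) by (apply sqrt_sqrt; lra).
split.
- apply (is_derive_ext (fun t => ln (sqrt ((x + t) * (x + t) + y * y)))).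
  { intros t. simpl. unfold Cmod; simpl. do 2 f_equal. ring. }
  auto_derive; fold v; fold r.
  + repeat split; trivial.
  + simpl. replace (v * (v * 1) + y * (y * 1)) with (r * r) by lra.
    field. lra.
- apply (is_derive_ext (fun t => 2 * atan (y / (sqrt ((x + t) * (x + t) + y * y) + (x + t))))).
  { intros t. simpl. unfold Carg, Cmod; simpl. do 4 f_equal; try f_equal; ring. }
  auto_derive; fold v; fold r.
  + repeat split; trivial. lra.
  + simpl. replace (v * (v * 1) + y * (y * 1)) with (r * r) by lra.
    unfold Rsqr.
    assert (Hd : (r + v) * (r + v) + y * y = 2 * r * (r + v)) by nra.
    transitivity (- (2 * y * ((r + v) / r)) / ((r + v) * (r + v) + y * y)).
    * field. repeat split; try lra; nra.
    * rewrite Hd. field. lra.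
Qed.

Lemma is_derivC_inv w u :
  (w + RtoC u)%C <> 0%C ->
  is_derivC (fun t => / (w + RtoC t))%C u (- (/ (w + RtoC u) ^ 2))%C.
Proof.
intros Hs. apply Cmod_gt_0 in Hs.
destruct w as [x y].
set (v := x + u).
assert (Ev : ((x, y) + RtoC u)%C = (v, y)) by (unfold v, RtoC, Cplus; simpl; f_equal; ring).
rewrite Ev in *.
assert (Hp : 0 < v * v + y * y).
{ replace (v * v + y * y) with (Cmod (v, y) ^ 2); [apply pow_lt, Hs|].
  rewrite Cmod2_alt. simpl. ring. }
split.
- apply (is_derive_ext (fun t => (x + t) / ((x + t) * (x + t) + y * y))).
  { intros t. simpl. f_equal; ring. }
  auto_derive; fold v.
  + repeat split; trivial; lra.
  + simpl. field. split; [|lra].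
    match goal with |- ?e <> 0 =>
      replace e with ((v * v + y * y) * (v * v + y * y)) by ring end.
    nra.
- apply (is_derive_ext (fun t => - y / ((x + t) * (x + t) + y * y))).
  { intros t. simpl. f_equal; ring. }
  auto_derive; fold v.
  + repeat split; trivial; lra.
  + simpl. field. split; [|lra].
    match goal with |- ?e <> 0 =>
      replace e with ((v * v + y * y) * (v * v + y * y)) by ring end.
    nra.
Qed.

(** Holds at 0 too, since [/ 0 = 0]. *)
Lemma Cinv_mult_total (a b : C) : (/ (a * b) = / a * / b)%C.
Proof.
assert (H0 : (/ 0 = 0)%C).
{ unfold Cinv, RtoC; simpl. f_equal; unfold Rdiv; ring. }
destruct (Req_dec (Cmod a) 0) as [Ha|Ha].
{ apply Cmod_eq_0 in Ha. subst a. rewrite Cmult_0_l, H0. ring. }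
destruct (Req_dec (Cmod b) 0) as [Hb|Hb].
{ apply Cmod_eq_0 in Hb. subst b. rewrite Cmult_0_r, H0. ring. }
field. split; intros E; subst; now rewrite Cmod_0 in *.
Qed.

Lemma is_derivC_eq F u D D' : is_derivC F u D -> D = D' -> is_derivC F u D'.
Proof. intros H <-. exact H. Qed.

Lemma is_derivC_inv_pow w u n :
  (w + RtoC u)%C <> 0%C ->
  is_derivC (fun t => / (w + RtoC t) ^ n)%C u
    (- RtoC (INR n) / (w + RtoC u) ^ S n)%C.
Proof.
intros Hs. induction n as [|n IH].
- apply (is_derivC_eq _ _ 0%C).
  + apply (is_derivC_ext (fun _ => / 1)%C); [reflexivity|apply is_derivC_const].
  + change (INR 0) with 0. rewrite Cpow_1_r. field. exact Hs.
- apply (is_derivC_ext (fun t => / (w + RtoC t) * / (w + RtoC t) ^ n)%C).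
  + intros t. rewrite Cpow_S, Cinv_mult_total. reflexivity.
  + assert (Hn : ((w + RtoC u) ^ n)%C <> 0%C) by (now apply Cpow_nz).
    eapply is_derivC_eq.
    * apply is_derivC_mult; [apply is_derivC_inv, Hs|exact IH].
    * rewrite S_INR, RtoC_plus.
      set (v := (w + RtoC u)%C) in *. clearbody v. rewrite !Cpow_S.
      set (p := (v ^ n)%C) in *. set (a := RtoC (INR n)). clearbody a p.
      field. split; assumption.
Qed.

(** * Euler-Maclaurin summation of the logarithm *)

(** Each member is the derivative of the previous one; index 1 is the logarithm. *)
Definition log_chain (n : nat) (w : C) : C :=
  match n with
  | O => (w * Clog w - w)%C
  | S O => Clog w
  | S (S p) => (RtoC ((-1) ^ p * INR (fact p)) * / w ^ S p)%C
  end.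

Lemma is_derivC_log_chain n w u :
  slit_plane (w + RtoC u)%C ->
  is_derivC (fun t => log_chain n (w + RtoC t)) u (log_chain (S n) (w + RtoC u)).
Proof.
intros Hs. pose proof (slit_plane_neq_0 _ Hs) as H0.
destruct n as [|[|p]]; cbn [log_chain].
- eapply is_derivC_eq.
  + apply is_derivC_minus; [apply is_derivC_mult|].
    * apply is_derivC_shift.
    * apply is_derivC_Clog, Hs.
    * apply is_derivC_shift.
  + cbv beta. field. exact H0.
- eapply is_derivC_eq; [apply is_derivC_Clog, Hs|].
  rewrite Cpow_1_r. change (INR (fact 0)) with 1. rewrite pow_O, Rmult_1_r.
  field. exact H0.
- eapply is_derivC_eq.
  + apply is_derivC_mult; [apply is_derivC_const|apply is_derivC_inv_pow, H0].
  + replace ((-1) ^ S p * INR (fact (S p))) with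
      (- ((-1) ^ p * INR (fact p) * INR (S p)))
      by (rewrite fact_simpl, mult_INR; simpl ((-1) ^ S p); ring).
    rewrite RtoC_opp, (RtoC_mult _ (INR (S p))). unfold Cdiv. ring.
Qed.

(** The Euler-Maclaurin expression, with the polynomials taken at [h]. *)
Fixpoint euler_sum (n : nat) (h : R) (w : C) : C :=
  match n with
  | O => (RtoC (bern 0 h) * log_chain 0 w)%C
  | S m => (euler_sum m h w + RtoC ((-1) ^ S m * bern (S m) h) * log_chain (S m) w)%C
  end.

(** The derivative telescopes, since [bern (S n)] is an antiderivative of
    [bern n] and [log_chain (S n)] is the derivative of [log_chain n]. *)
Lemma is_derivC_euler_sum n a w u :
  slit_plane (w + RtoC u)%C ->
  is_derivC (fun t => euler_sum n (a + t) (w + RtoC t)) u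
    (RtoC ((-1) ^ n * bern n (a + u)) * log_chain (S n) (w + RtoC u))%C.
Proof.
intros Hs. induction n as [|n IH].
- cbn [euler_sum]. eapply is_derivC_eq.
  + apply is_derivC_mult; [|apply is_derivC_log_chain, Hs].
    apply is_derivC_real with (d := 0).
    apply (is_derive_ext (fun _ => 1)); [intros; symmetry; apply bern_0|].
    apply (is_derive_const (V := R_NormedModule)).
  + cbv beta. rewrite pow_O, Rmult_1_l. ring.
- cbn [euler_sum]. eapply is_derivC_eq.
  + apply is_derivC_plus; [exact IH|].
    apply is_derivC_mult; [|apply is_derivC_log_chain, Hs].
    apply is_derivC_real.
    apply (is_derive_scal (fun t => bern (S n) (a + t))), is_derive_bern_shift.
  + unfold mult; simpl ((-1) ^ S n). simpl. rewrite !RtoC_mult. ring_simplify.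
    replace (RtoC (-1)) with (- (1))%C by (now rewrite <- RtoC_opp). ring.
Qed.

(** Only the first periodic Bernoulli polynomial jumps at the integers; its jump
    produces the value of the logarithm at the midpoint. *)
Lemma euler_sum_jump n w :
  (euler_sum (S n) 1 w = euler_sum (S n) 0 w - Clog w)%C.
Proof.
induction n as [|n IH].
- cbn [euler_sum]. rewrite !bern_0, !bern_1. cbn [log_chain pow].
  replace (-1 * 1 * (1 - 1 / 2)) with (- 1 - (-1 * 1 * (1 / 2))) by field.
  replace (-1 * 1 * (0 - 1 / 2)) with (0 - (-1 * 1 * (1 / 2))) by field.
  rewrite !RtoC_minus. replace (RtoC (-1)) with (- (1))%C by (now rewrite <- RtoC_opp).
  ring.
- remember (S n) as m eqn:Em. cbn [euler_sum]. rewrite IH. subst m.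
  rewrite bern_periodic. ring.
Qed.

Lemma T_hat_log_chain j (w : C) :
  w <> 0%C ->
  T_hat (S j) w
  = (RtoC (bern (2 * S j) (1 / 2)) * log_chain (2 * S j) w)%C.
Proof.
intros Hw. unfold T_hat.
replace (2 * S j)%nat with (S (S (2 * j))) by lia. cbn [log_chain].
replace (S (S (2 * j)) - 1)%nat with (S (2 * j)) by lia.
rewrite pow_1_even, Rmult_1_l. unfold bern.
rewrite !fact_simpl, !mult_INR.
replace (INR (S (S (2 * j)))) with (2 * INR (S j)) by (rewrite !S_INR, mult_INR; simpl; ring).
replace (INR (S (2 * j))) with (2 * INR (S j) - 1) by (rewrite !S_INR, mult_INR; simpl; ring).
assert (H1 : 1 <= INR (S j)) by (rewrite S_INR; pose proof (pos_INR j); lra).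
pose proof (INR_fact_neq_0 (2 * j)) as H2.
set (b := bernoulli_poly _ _). set (a := INR (S j)) in *. set (f := INR (fact (2 * j))) in *.
assert (Hp : (w ^ S (2 * j))%C <> 0%C) by (apply Cpow_nz, Hw).
set (p := (w ^ S (2 * j))%C) in *.
unfold Rdiv. rewrite !RtoC_mult, RtoC_inv, !RtoC_mult.
2:{ repeat apply Rmult_integral_contrapositive_currified; lra || exact H2. }
assert (Hf : RtoC f <> 0%C) by (intros E; apply RtoC_inj in E; lra).
assert (Ha : RtoC a <> 0%C) by (intros E; apply RtoC_inj in E; lra).
assert (Ha1 : RtoC (2 * a - 1) <> 0%C) by (intros E; apply RtoC_inj in E; lra).
field. repeat split; trivial; intros E; apply RtoC_inj in E; lra.
Qed.

Definition stirling_main (m : nat) (w : C) : C :=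
  (w * Clog w - w + sum_n_m (fun j => T_hat j w) 1 m)%C.

Lemma sum_n_m_T_hat_S m w :
  sum_n_m (fun j => T_hat j w) 1 (S m)
  = (sum_n_m (fun j => T_hat j w) 1 m + T_hat (S m) w)%C.
Proof. rewrite sum_n_Sm by lia. reflexivity. Qed.

(** The odd Bernoulli polynomials vanish at 1/2, and the even ones give [T_hat]. *)
Lemma stirling_main_euler_sum m (w : C) :
  w <> 0%C -> stirling_main m w = euler_sum (2 * m) (1 / 2) w.
Proof.
intros Hw. unfold stirling_main. induction m as [|m IH].
- rewrite sum_n_m_zero by lia. change (2 * 0)%nat with 0%nat.
  cbn [euler_sum log_chain]. rewrite bern_0.
  change (zero : C) with (RtoC 0). ring.
- rewrite sum_n_m_T_hat_S, T_hat_log_chain by exact Hw.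
  replace (2 * S m)%nat with (S (S (2 * m))) by lia.
  cbn [euler_sum]. rewrite <- IH, bern_odd_half.
  replace (S (S (2 * m))) with (2 * S m)%nat by lia. rewrite pow_1_even, !Rmult_1_l, Rmult_0_r.
  ring.
Qed.

Lemma slit_plane_shift w u : slit_plane w -> 0 <= u -> slit_plane (w + RtoC u)%C.
Proof.
unfold slit_plane, Re, Im; simpl.
intros [H|H] Hu; [left; lra|right; intros E; apply H; lra].
Qed.

(** On each half of the unit interval the increment of [euler_sum] is the
    integral of its derivative, a single term in [bern (2 m)]. Since the midpoint
    is where the periodic polynomials have their jump, the two halves use the
    polynomials at [1/2 + u] and [u - 1/2]. *)
Lemma midpoint_step m w (g dg : R -> R) :
  (1 <= m)%nat -> slit_plane w ->
  (forall u, 0 <= u <= 1 -> is_derive g u (dg u)) ->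
  (forall u, 0 <= u <= 1 -> Cmod (log_chain (S (2 * m)) (w + RtoC u)) <= dg u) ->
  Cmod (stirling_main m (w + 1) - stirling_main m w - Clog (w + RtoC (1 / 2)))%C
  <= eta m * Rabs (bern (2 * m) (1 / 2)) * (g 1 - g 0).
Proof.
intros Hm Hw Hg Hb.
set (B := eta m * Rabs (bern (2 * m) (1 / 2))).
assert (Hhalf : forall a b c, 0 <= b <= c -> c <= 1 -> 0 <= a + b -> a + c <= 1 ->
  Cmod (euler_sum (2 * m) (a + c) (w + RtoC c) - euler_sum (2 * m) (a + b) (w + RtoC b))%C
  <= B * g c - B * g b).
{ intros a b c Hbc Hc1 Hab Hac.
  apply (Cmod_increment_le (fun t => euler_sum (2 * m) (a + t) (w + RtoC t))
    (fun u => RtoC ((-1) ^ (2 * m) * bern (2 * m) (a + u))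
              * log_chain (S (2 * m)) (w + RtoC u))%C
    (fun t => B * g t) (fun t => B * dg t)); [lra| | |].
  - intros u Hu. apply is_derivC_euler_sum, slit_plane_shift; [exact Hw|lra].
  - intros u Hu. apply is_derive_scal, Hg. lra.
  - intros u Hu. rewrite Cmod_mult, Cmod_R, pow_1_even, Rmult_1_l.
    apply Rmult_le_compat; try apply Rabs_pos; try apply Cmod_ge_0.
    + apply bern_even_bound; [exact Hm|lra].
    + apply Hb. lra. }
pose proof (Hhalf (1 / 2) 0 (1 / 2) ltac:(lra) ltac:(lra) ltac:(lra) ltac:(lra)) as H1.
pose proof (Hhalf (- (1 / 2)) (1 / 2) 1 ltac:(lra) ltac:(lra) ltac:(lra) ltac:(lra)) as H2.
replace (1 / 2 + 1 / 2) with 1 in H1 by field.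
replace (1 / 2 + 0) with (1 / 2) in H1 by ring.
replace (- (1 / 2) + 1) with (1 / 2) in H2 by field.
replace (- (1 / 2) + 1 / 2) with 0 in H2 by ring.
replace (w + RtoC 0)%C with w in H1 by ring.
destruct m as [|p]; [lia|].
replace (2 * S p)%nat with (S (S (2 * p))) in H1, H2 by lia.
rewrite euler_sum_jump in H1.
replace (S (S (2 * p))) with (2 * S p)%nat in H1, H2 by lia.
assert (Hw0 := slit_plane_neq_0 w Hw).
assert (Hw1 := slit_plane_neq_0 _ (slit_plane_shift w 1 Hw Rle_0_1)).
rewrite <- (stirling_main_euler_sum _ _ Hw0) in H1.
rewrite <- (stirling_main_euler_sum _ _ Hw1) in H2.
set (mid := euler_sum _ 0 _) in *.
replace (B * (g 1 - g 0)) with ((B * g 1 - B * g (1 / 2)) + (B * g (1 / 2) - B * g 0)) by ring.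
eapply Rle_trans; [|apply Rplus_le_compat; [exact H2|exact H1]].
eapply Rle_trans; [|apply Cmod_triangle]. apply Req_le. f_equal. ring.
Qed.

(** Its derivative dominates [(2m-1)! / (r^2 + u^2)^m] when [s^2 <= m], because then
    [(1 + (u/r)^2)^m >= 1 + m (u/r)^2 >= 1 + (s u / r)^2] by Bernoulli's inequality.
    Its total increment, proportional to [1 / s], is where the saving of a factor
    [sqrt m] over the trivial bound comes from. *)
Definition atan_majorant (m : nat) (r s u : R) : R :=
  INR (fact (2 * m - 1)) / (r ^ (2 * m - 1) * s) * atan (s * u / r).

Definition atan_majorant' (m : nat) (r s u : R) : R :=
  INR (fact (2 * m - 1)) / (r ^ (2 * m) * (1 + (s * u / r) ^ 2)).

Lemma is_derive_atan_majorant m r s u :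
  (1 <= m)%nat -> 0 < r -> 0 < s ->
  is_derive (atan_majorant m r s) u (atan_majorant' m r s u).
Proof.
intros Hm Hr Hs. unfold atan_majorant, atan_majorant'.
evar_last.
- apply is_derive_scal.
  apply (is_derive_comp atan (fun u => s * u / r)); [apply is_derive_atan|].
  auto_derive; [trivial|reflexivity].
- unfold scal; simpl; unfold mult; simpl.
  replace (2 * m)%nat with (S (2 * m - 1)) at 4 by lia.
  change (m + (m + 0))%nat with (2 * m)%nat.
  assert (r ^ (2 * m - 1) <> 0) by (apply pow_nonzero; lra).
  set (p := r ^ (2 * m - 1)) in *.
  replace (r ^ S (2 * m - 1)) with (r * p) by reflexivity.
  assert (0 < r * r + s * u * (s * u)) by nra.
  unfold Rsqr. field. repeat split; try lra; try assumption; nra.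
Qed.

Lemma Cmod_shift_sqr z u :
  0 <= Re z -> 0 <= u -> Cmod z ^ 2 + u ^ 2 <= Cmod (z + RtoC u)%C ^ 2.
Proof.
intros Hz Hu. rewrite !Cmod2_alt. pose proof (Rmult_le_pos _ _ Hz Hu).
destruct z as [x y]. simpl in *. nra.
Qed.

Lemma Cmod_log_chain_le m (z : C) s u :
  (1 <= m)%nat -> 0 <= Re z -> z <> 0%C -> 0 < s -> s ^ 2 <= INR m -> 0 <= u ->
  Cmod (log_chain (S (2 * m)) (z + RtoC u)) <= atan_majorant' m (Cmod z) s u.
Proof.
intros Hm Hz H0 Hs Hsm Hu.
assert (Hr : 0 < Cmod z) by (now apply Cmod_gt_0).
set (r := Cmod z) in *.
pose proof (Cmod_shift_sqr z u Hz Hu) as H2. fold r in H2.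
set (q := Cmod (z + RtoC u)%C) in *.
assert (Hq0 : 0 <= q) by apply Cmod_ge_0.
assert (Hq : 0 < q) by (destruct Hq0 as [|E]; [trivial|rewrite <- E in H2; nra]).
unfold atan_majorant'.
replace (S (2 * m)) with (S (S (2 * m - 1))) by lia.
cbn [log_chain].
rewrite Cmod_mult, Cmod_R, Rabs_pow_m1_mult, Rabs_pos_eq by apply pos_INR.
replace (S (2 * m - 1)) with (2 * m)%nat by lia.
rewrite Cmod_inv, Cmod_pow.
2:{ apply Cpow_nz, Cmod_gt_0. exact Hq. }
fold q. apply Rmult_le_compat_l; [apply pos_INR|].
apply Rinv_le_contravar.
- apply Rmult_lt_0_compat; [apply pow_lt, Hr|]. pose proof (pow2_ge_0 (s * u / r)). lra.
- rewrite !pow_mult.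
  apply Rle_trans with ((r ^ 2 + u ^ 2) ^ m).
  2:{ apply pow_incr. split; [nra|exact H2]. }
  replace (r ^ 2 + u ^ 2) with (r ^ 2 * (1 + (u / r) ^ 2)) by (field; lra).
  rewrite Rpow_mult_distr. apply Rmult_le_compat_l; [apply pow_le; nra|].
  apply Rle_trans with (1 + INR m * (u / r) ^ 2).
  + replace (s * u / r) with (s * (u / r)) by (field; lra).
    rewrite Rpow_mult_distr. pose proof (pow2_ge_0 (u / r)). nra.
  + destruct (Req_dec u 0) as [->|Hu0].
    * replace (0 / r) with 0 by (field; lra). simpl.
      replace (1 + 0 * (0 * 1)) with 1 by ring. rewrite pow1. lra.
    * apply poly. apply pow_lt. apply Rdiv_lt_0_compat; lra.
Qed.

Fixpoint midpoint_log_sum (z : C) (n : nat) : C :=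
  match n with
  | O => 0%C
  | S p => (midpoint_log_sum z p + Clog (z + RtoC (INR p) + RtoC (1 / 2)))%C
  end.

(** Its limit in [n] will be [R_hat f (m + 1) z]. *)
Definition euler_remainder (m : nat) (z : C) (n : nat) : C :=
  (stirling_main m (z + RtoC (INR n)) - stirling_main m z - midpoint_log_sum z n)%C.

Lemma Re_nonneg_slit_plane (z : C) : 0 <= Re z -> z <> 0%C -> slit_plane z.
Proof.
intros H H0. unfold slit_plane.
destruct (Req_dec (Im z) 0) as [E|E]; [left|right; exact E].
destruct H as [H|H]; [exact H|]. exfalso. apply H0. destruct z as [x y].
simpl in *. subst. reflexivity.
Qed.

Lemma euler_remainder_increment m (z : C) s n p :
  (1 <= m)%nat -> 0 <= Re z -> z <> 0%C -> 0 < s -> s ^ 2 <= INR m ->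
  Cmod (euler_remainder m z (n + p) - euler_remainder m z n)%C
  <= eta m * Rabs (bern (2 * m) (1 / 2))
     * (atan_majorant m (Cmod z) s (INR (n + p)) - atan_majorant m (Cmod z) s (INR n)).
Proof.
intros Hm Hz H0 Hs Hsm.
assert (Hr : 0 < Cmod z) by (now apply Cmod_gt_0).
set (g := atan_majorant m (Cmod z) s).
induction p as [|p IH].
- rewrite Nat.add_0_r.
  replace (euler_remainder m z n - euler_remainder m z n)%C with (RtoC 0) by ring.
  rewrite Cmod_0. lra.
- rewrite Nat.add_succ_r. set (N := (n + p)%nat) in *.
  assert (Hstep := midpoint_step m (z + RtoC (INR N))
    (fun u => g (INR N + u)) (fun u => atan_majorant' m (Cmod z) s (INR N + u)) Hm).
  pose proof (pos_INR N) as HN.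
  lapply Hstep; [clear Hstep; intros Hstep|
    apply slit_plane_shift; [now apply Re_nonneg_slit_plane|exact HN]].
  lapply Hstep; [clear Hstep; intros Hstep|].
  2:{ intros u Hu. evar_last.
      - apply (is_derive_comp g (fun u => INR N + u));
          [apply is_derive_atan_majorant; trivial|].
        auto_derive; [trivial|reflexivity].
      - unfold scal; simpl; unfold mult; simpl. ring. }
  lapply Hstep; [clear Hstep; intros Hstep|].
  2:{ intros u Hu. rewrite <- Cplus_assoc, <- RtoC_plus.
      apply Cmod_log_chain_le; trivial. lra. }
  cbv beta in Hstep. rewrite Rplus_0_r, <- S_INR in Hstep.
  rewrite <- Cplus_assoc, <- RtoC_plus, <- S_INR in Hstep.
  set (B := eta m * Rabs (bern (2 * m) (1 / 2))) in *.
  replace (B * (g (INR (S N)) - g (INR n)))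
    with (B * (g (INR (S N)) - g (INR N)) + B * (g (INR N) - g (INR n))) by ring.
  eapply Rle_trans; [|apply Rplus_le_compat; [exact Hstep|exact IH]].
  eapply Rle_trans; [|apply Cmod_triangle]. apply Req_le. f_equal.
  unfold euler_remainder. cbn [midpoint_log_sum]. ring.
Qed.

(** * Convergence of the remainder *)

Definition is_lim_seqC (u : nat -> C) (l : C) : Prop :=
  is_lim_seq (fun n => Re (u n)) (Re l) /\ is_lim_seq (fun n => Im (u n)) (Im l).

Lemma is_lim_seqC_ext u v l :
  (forall n, u n = v n) -> is_lim_seqC u l -> is_lim_seqC v l.
Proof.
intros E [H1 H2]; split.
- apply (is_lim_seq_ext (fun n => Re (u n))); [intros n; now rewrite E|exact H1].
- apply (is_lim_seq_ext (fun n => Im (u n))); [intros n; now rewrite E|exact H2].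
Qed.

Lemma is_lim_seqC_plus u v l m :
  is_lim_seqC u l -> is_lim_seqC v m -> is_lim_seqC (fun n => u n + v n)%C (l + m)%C.
Proof. intros [H1 H2] [H3 H4]; split; now apply is_lim_seq_plus'. Qed.

Lemma is_lim_seqC_minus u v l m :
  is_lim_seqC u l -> is_lim_seqC v m -> is_lim_seqC (fun n => u n - v n)%C (l - m)%C.
Proof. intros [H1 H2] [H3 H4]; split; now apply is_lim_seq_minus'. Qed.

Lemma is_lim_seqC_mult u v l m :
  is_lim_seqC u l -> is_lim_seqC v m -> is_lim_seqC (fun n => u n * v n)%C (l * m)%C.
Proof.
intros [H1 H2] [H3 H4]; split.
- apply is_lim_seq_minus'; now apply is_lim_seq_mult'.
- apply is_lim_seq_plus'; now apply is_lim_seq_mult'.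
Qed.

Lemma is_lim_seqC_const c : is_lim_seqC (fun _ => c) c.
Proof. split; apply is_lim_seq_const. Qed.

Lemma is_lim_seqC_real u (l : R) : is_lim_seq u l -> is_lim_seqC (fun n => RtoC (u n)) l.
Proof. intros H; split; [exact H|apply is_lim_seq_const]. Qed.

Lemma is_lim_seqC_incr_1 u l : is_lim_seqC u l -> is_lim_seqC (fun n => u (S n)) l.
Proof.
intros [H1 H2]; split;
  [apply (is_lim_seq_incr_1 (fun n => Re (u n)))|apply (is_lim_seq_incr_1 (fun n => Im (u n)))];
  assumption.
Qed.

Lemma Re_le_Cmod (c : C) : - Cmod c <= Re c <= Cmod c.
Proof. apply Rabs_le_between, re_le_Cmod. Qed.

Lemma Im_le_Cmod (c : C) : - Cmod c <= Im c <= Cmod c.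
Proof.
apply Rabs_le_between. eapply Rle_trans; [|apply (Rmax_Cmod c)]. apply Rmax_r.
Qed.

Lemma is_lim_seqC_0_of_Cmod u (b : nat -> R) :
  (forall n, Cmod (u n) <= b n) -> is_lim_seq b 0 -> is_lim_seqC u 0.
Proof.
intros Hb H.
assert (H' : is_lim_seq (fun n => - b n) 0).
{ replace (Finite 0) with (Rbar_opp 0) by (simpl; f_equal; ring).
  now apply (is_lim_seq_opp b 0). }
split; apply (is_lim_seq_le_le (fun n => - b n) _ b); trivial; intros n.
- pose proof (Re_le_Cmod (u n)). specialize (Hb n). lra.
- pose proof (Im_le_Cmod (u n)). specialize (Hb n). lra.
Qed.

(** Rotating the limit onto the positive axis reduces the bound to real parts. *)
Lemma is_lim_seqC_Cmod_le u l b :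
  is_lim_seqC u l -> (forall n, Cmod (u n) <= b) -> Cmod l <= b.
Proof.
intros H Hb.
destruct (Cmod_rotation l) as [w [Hw E]].
destruct (is_lim_seqC_mult _ _ _ _ (is_lim_seqC_const w) H) as [H1 _].
rewrite E in H1.
apply (is_lim_seq_le (fun n => Re (w * u n)%C) (fun _ => b) (Cmod l) b); trivial.
- intros n. apply Rle_trans with (Cmod (w * u n)%C); [apply Re_le_Cmod|].
  rewrite Cmod_mult, Hw, Rmult_1_l. apply Hb.
- apply is_lim_seq_const.
Qed.

Lemma is_lim_seqC_cauchy (u : nat -> C) (g : nat -> R) :
  (forall n p, Cmod (u (n + p)%nat - u n)%C <= g (n + p)%nat - g n) ->
  ex_finite_lim_seq g -> exists l, is_lim_seqC u l.
Proof.
intros H Hg. apply ex_lim_seq_cauchy_corr in Hg.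
assert (HR : forall p : C -> R, (forall a b, p (a - b)%C = p a - p b) ->
  (forall a, Rabs (p a) <= Cmod a) -> ex_finite_lim_seq (fun n => p (u n))).
{ intros p Hp1 Hp2. apply ex_lim_seq_cauchy_corr. intros eps.
  destruct (Hg eps) as [N HN]. exists N. intros n m Hn Hm.
  destruct (Nat.le_ge_cases n m) as [L|L].
  - rewrite Rabs_minus_sym, <- Hp1. eapply Rle_lt_trans; [apply Hp2|].
    replace m with (n + (m - n))%nat in * by lia.
    eapply Rle_lt_trans; [apply H|].
    eapply Rle_lt_trans; [apply Rle_abs|]. now apply HN.
  - rewrite <- Hp1. eapply Rle_lt_trans; [apply Hp2|].
    replace n with (m + (n - m))%nat in * by lia.
    eapply Rle_lt_trans; [apply H|].
    eapply Rle_lt_trans; [apply Rle_abs|]. now apply HN. }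
destruct (HR Re) as [a Ha].
{ intros; simpl; unfold Re; ring. }
{ intros; apply re_le_Cmod. }
destruct (HR Im) as [b Hb].
{ intros; simpl; unfold Im; ring. }
{ intros; apply Rabs_le_between, Im_le_Cmod. }
exists (a, b). split; assumption.
Qed.

Lemma atan_majorant_increasing m r s u v :
  (1 <= m)%nat -> 0 < r -> 0 < s -> u <= v ->
  atan_majorant m r s u <= atan_majorant m r s v.
Proof.
intros Hm Hr Hs Huv.
apply (derive_nonneg_le _ (atan_majorant' m r s)); trivial.
- intros. now apply is_derive_atan_majorant.
- intros c _. unfold atan_majorant'.
  apply Rmult_le_pos; [apply pos_INR|]. apply Rlt_le, Rinv_0_lt_compat.
  apply Rmult_lt_0_compat; [now apply pow_lt|].
  pose proof (pow2_ge_0 (s * c / r)). lra.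
Qed.

Definition remainder_bound (m : nat) (r s : R) : R :=
  eta m * Rabs (bern (2 * m) (1 / 2)) *
  (INR (fact (2 * m - 1)) / (r ^ (2 * m - 1) * s) * (PI / 2)).

Lemma atan_majorant_le m r s u :
  0 < r -> 0 < s ->
  atan_majorant m r s u - atan_majorant m r s 0
  <= INR (fact (2 * m - 1)) / (r ^ (2 * m - 1) * s) * (PI / 2).
Proof.
intros Hr Hs. unfold atan_majorant.
replace (s * 0 / r) with 0 by (field; lra). rewrite atan_0, Rmult_0_r, Rminus_0_r.
apply Rmult_le_compat_l.
- apply Rmult_le_pos; [apply pos_INR|]. apply Rlt_le, Rinv_0_lt_compat.
  apply Rmult_lt_0_compat; [now apply pow_lt|exact Hs].
- pose proof (atan_bound (s * u / r)). lra.
Qed.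

Lemma eta_bern_pos m : (1 <= m)%nat -> 0 <= eta m * Rabs (bern (2 * m) (1 / 2)).
Proof.
intros Hm. pose proof (eta_ge_1 m Hm).
apply Rmult_le_pos; [lra|apply Rabs_pos].
Qed.

Lemma euler_remainder_converges m (z : C) s :
  (1 <= m)%nat -> 0 <= Re z -> z <> 0%C -> 0 < s -> s ^ 2 <= INR m ->
  exists l, is_lim_seqC (euler_remainder m z) l
            /\ Cmod l <= remainder_bound m (Cmod z) s.
Proof.
intros Hm Hz H0 Hs Hsm.
assert (Hr : 0 < Cmod z) by (now apply Cmod_gt_0).
set (B := eta m * Rabs (bern (2 * m) (1 / 2))).
assert (HB : 0 <= B) by (now apply eta_bern_pos).
assert (Hinc := fun n p => euler_remainder_increment m z s n p Hm Hz H0 Hs Hsm).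
fold B in Hinc.
destruct (is_lim_seqC_cauchy (euler_remainder m z)
  (fun n => B * (atan_majorant m (Cmod z) s (INR n) - atan_majorant m (Cmod z) s 0)))
  as [l Hl].
- intros n p. eapply Rle_trans; [apply Hinc|]. lra.
- apply (ex_finite_lim_seq_incr _ (remainder_bound m (Cmod z) s)).
  + intros n. apply Rmult_le_compat_l; [exact HB|].
    apply Rplus_le_compat_r, atan_majorant_increasing; trivial. apply le_INR; lia.
  + intros n. apply Rmult_le_compat_l; [exact HB|]. now apply atan_majorant_le.
- exists l. split; [exact Hl|]. apply (is_lim_seqC_Cmod_le _ _ _ Hl).
  intros n. pose proof (Hinc O n) as H. simpl (0 + n)%nat in H.
  replace (euler_remainder m z 0) with (RtoC 0) in H.
  2:{ unfold euler_remainder. cbn [midpoint_log_sum]. change (INR 0) with 0.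
      rewrite Cplus_0_r. ring. }
  replace (euler_remainder m z n - 0)%C with (euler_remainder m z n) in H by ring.
  eapply Rle_trans; [exact H|]. apply Rmult_le_compat_l; [exact HB|].
  now apply atan_majorant_le.
Qed.

Lemma is_lim_seq_inv_INR : is_lim_seq (fun n => / INR n) 0.
Proof.
replace (Finite 0) with (Rbar_inv p_infty) by reflexivity.
apply is_lim_seq_inv; [apply is_lim_seq_INR|discriminate].
Qed.

Lemma is_lim_seq_scaled_increment (f : R -> R) (l : R) :
  is_derive f 0 l -> f 0 = 0 -> is_lim_seq (fun n => INR n * f (/ INR n)) l.
Proof.
intros Hd H0. apply is_derive_Reals in Hd.
apply is_lim_seq_spec. intros eps.
destruct (Hd eps (cond_pos eps)) as [d H].
assert (HL := proj2 (is_lim_seq_spec _ _) is_lim_seq_inv_INR d).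
destruct HL as [N HN]. exists (S N). intros n Hn.
assert (Hp : 0 < INR n) by (apply lt_0_INR; lia).
specialize (HN n ltac:(lia)). rewrite Rminus_0_r in HN.
specialize (H (/ INR n) (Rgt_not_eq _ _ (Rinv_0_lt_compat _ Hp)) HN).
rewrite Rplus_0_l, H0, Rminus_0_r in H.
replace (INR n * f (/ INR n)) with (f (/ INR n) / / INR n) by (field; lra).
exact H.
Qed.

(** [n Log (1 + w/n)] tends to [w]: differentiate [Log (1 + w s)] at [s = 0],
    one component at a time. *)
Lemma is_lim_seq_scaled_log (w : C) :
  is_lim_seqC (fun n => RtoC (INR n) * (Clog (w + RtoC (INR n)) - RtoC (ln (INR n))))%C w.
Proof.
destruct w as [x y].
set (Q := fun s => (1 + x * s) * (1 + x * s) + (y * s) * (y * s)).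
assert (E : forall n, (1 <= n)%nat ->
   Cmod ((x, y) + RtoC (INR n))%C = INR n * sqrt (Q (/ INR n))).
{ intros n Hn. assert (Hp : 0 < INR n) by (apply lt_0_INR; lia).
  unfold Cmod, Q; simpl.
  rewrite <- (sqrt_square (INR n)) at 3 by lra. rewrite <- sqrt_mult_alt by nra.
  f_equal. field. lra. }
split.
- apply is_lim_seq_ext_loc with
    (fun n => INR n * (fun s => ln (sqrt (Q s))) (/ INR n)).
  + assert (HQ : eventually (fun n => 0 < Q (/ INR n))).
    { assert (HL : is_lim_seq (fun n => Q (/ INR n)) 1).
      { replace (Finite 1) with (Finite (Q 0)) by (unfold Q; f_equal; ring).
        apply (is_lim_seq_continuous Q); [|apply is_lim_seq_inv_INR].
        unfold Q. reg. }
      apply is_lim_seq_spec in HL. destruct (HL (mkposreal 1 Rlt_0_1)) as [N HN].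
      exists N. intros n Hn. specialize (HN n Hn). simpl in HN.
      apply Rabs_lt_between in HN. lra. }
    destruct HQ as [N HN]. exists (S N). intros n Hn.
    specialize (HN n ltac:(lia)).
    assert (Hp : 0 < INR n) by (apply lt_0_INR; lia).
    simpl. rewrite E by lia.
    rewrite ln_mult; [ring|exact Hp|now apply sqrt_lt_R0].
  + apply (is_lim_seq_scaled_increment (fun s => ln (sqrt (Q s)))).
    * unfold Q. auto_derive; rewrite !Rmult_0_r, !Rplus_0_r, !Rmult_1_r.
      -- rewrite sqrt_1. lra.
      -- rewrite sqrt_1. simpl. field.
    * unfold Q. rewrite !Rmult_0_r, !Rplus_0_r, Rmult_1_r, sqrt_1. apply ln_1.
- apply is_lim_seq_ext_loc with
    (fun n => INR n * (fun s => 2 * atan (y * s / (sqrt (Q s) + (1 + x * s)))) (/ INR n)).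
  + exists 1%nat. intros n Hn.
    assert (Hp : 0 < INR n) by (apply lt_0_INR; lia).
    unfold Clog. simpl. unfold Carg. rewrite E by lia. simpl.
    rewrite Rmult_0_l, !Rplus_0_r, Ropp_0, Rplus_0_r. do 3 f_equal.
    replace (INR n * sqrt (Q (/ INR n)) + (x + INR n))
      with (INR n * (sqrt (Q (/ INR n)) + (1 + x * / INR n))) by (field; lra).
    unfold Rdiv. rewrite Rinv_mult. ring.
  + apply (is_lim_seq_scaled_increment
             (fun s => 2 * atan (y * s / (sqrt (Q s) + (1 + x * s))))).
    * unfold Q. auto_derive; rewrite !Rmult_0_r, !Rplus_0_r, !Rmult_1_r.
      -- rewrite sqrt_1. repeat split; lra.
      -- rewrite sqrt_1. unfold Rsqr, Rdiv. rewrite !Rmult_0_l. simpl. field.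
    * rewrite Rmult_0_r. unfold Rdiv. rewrite Rmult_0_l, atan_0. ring.
Qed.

Lemma is_lim_seq_wlogw (w : C) :
  is_lim_seqC (fun n => (w + RtoC (INR n)) * Clog (w + RtoC (INR n)) - (w + RtoC (INR n))
     - (w + RtoC (INR n)) * RtoC (ln (INR n)) + RtoC (INR n))%C 0.
Proof.
pose proof (is_lim_seq_scaled_log w) as H1.
assert (H2 : is_lim_seqC (fun n => Clog (w + RtoC (INR n)) - RtoC (ln (INR n)))%C 0).
{ assert (H := is_lim_seqC_mult _ _ _ _ (is_lim_seqC_real _ _ is_lim_seq_inv_INR) H1).
  rewrite Cmult_0_l in H. apply (is_lim_seqC_incr_1) in H.
  assert (Hx : is_lim_seqC (fun n => Clog (w + RtoC (INR (S n))) - RtoC (ln (INR (S n))))%C 0).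
  { eapply is_lim_seqC_ext; [|exact H]. intros n. cbv beta.
    rewrite RtoC_inv by (apply not_0_INR; lia).
    assert (RtoC (INR (S n)) <> 0%C)
      by (intros E; apply RtoC_inj in E; revert E; apply not_0_INR; lia).
    field. assumption. }
  destruct Hx as [Ha Hb]; split; apply is_lim_seq_incr_1; assumption. }
assert (H3 := is_lim_seqC_mult _ _ _ _ (is_lim_seqC_const w) H2).
assert (H := is_lim_seqC_minus _ _ _ _ (is_lim_seqC_plus _ _ _ _ H1 H3)
   (is_lim_seqC_const w)).
replace (w + w * 0 - w)%C with (RtoC 0) in H by ring.
eapply is_lim_seqC_ext; [|exact H]. intros n. cbv beta. ring.
Qed.

Lemma Cmod_T_hat j (w : C) :
  (1 <= j)%nat -> w <> 0%C ->
  Cmod (T_hat j w)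
  = Rabs (bern (2 * j) (1 / 2)) * INR (fact (2 * j - 2)) / Cmod w ^ (2 * j - 1).
Proof.
intros Hj Hw. destruct j as [|p]; [lia|].
rewrite T_hat_log_chain by exact Hw.
replace (2 * S p)%nat with (S (S (2 * p))) by lia. cbn [log_chain].
rewrite !Cmod_mult, !Cmod_R, Rabs_pow_m1_mult, Cmod_inv by (now apply Cpow_nz).
rewrite Cmod_pow, (Rabs_pos_eq (INR _)) by apply pos_INR.
replace (S (S (2 * p)) - 2)%nat with (2 * p)%nat by lia.
replace (S (S (2 * p)) - 1)%nat with (S (2 * p)) by lia.
unfold Rdiv. ring.
Qed.

Lemma is_lim_seq_T_hat j (z : C) :
  (1 <= j)%nat -> 0 <= Re z ->
  is_lim_seqC (fun n => T_hat j (z + RtoC (INR (S n)))) 0.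
Proof.
intros Hj Hz.
set (K := Rabs (bern (2 * j) (1 / 2)) * INR (fact (2 * j - 2))).
apply (is_lim_seqC_0_of_Cmod _ (fun n => K * / INR (S n))).
- intros n.
  assert (Hn : 1 <= INR (S n)) by (rewrite S_INR; pose proof (pos_INR n); lra).
  assert (H1 : INR (S n) <= Cmod (z + RtoC (INR (S n)))%C).
  { eapply Rle_trans; [|apply Re_le_Cmod].
    change (Re (z + RtoC (INR (S n)))%C) with (Re z + INR (S n)). lra. }
  rewrite Cmod_T_hat by (trivial; apply Cmod_gt_0; lra). fold K.
  apply Rmult_le_compat_l; [apply Rmult_le_pos; [apply Rabs_pos|apply pos_INR]|].
  apply Rinv_le_contravar; [lra|].
  eapply Rle_trans; [exact H1|].
  rewrite <- (pow_1 (Cmod _)) at 1. apply Rle_pow; [lra|lia].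
- replace (Finite 0) with (Rbar_mult K 0) by (simpl; f_equal; ring).
  apply is_lim_seq_scal_l, (is_lim_seq_incr_1 (fun n => / INR n)), is_lim_seq_inv_INR.
Qed.

Lemma is_lim_seq_T_hat_sum m (z : C) :
  0 <= Re z ->
  is_lim_seqC (fun n => sum_n_m (fun j => T_hat j (z + RtoC (INR (S n)))%C) 1 m) 0.
Proof.
intros Hz. induction m as [|m IH].
- apply (is_lim_seqC_ext (fun _ => 0%C)); [|apply is_lim_seqC_const].
  intros n. now rewrite sum_n_m_zero by lia.
- apply (is_lim_seqC_ext (fun n => sum_n_m (fun j => T_hat j (z + RtoC (INR (S n)))%C) 1 m
       + T_hat (S m) (z + RtoC (INR (S n))))%C).
  + intros n. now rewrite sum_n_m_T_hat_S.
  + replace (RtoC 0) with (0 + 0)%C by ring.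
    apply is_lim_seqC_plus; [exact IH|]. apply is_lim_seq_T_hat; [lia|exact Hz].
Qed.

(** * Stirling's constant *)

(** An antiderivative of [sin ^ n]. *)
Fixpoint sin_pow_prim (n : nat) (t : R) : R :=
  match n with
  | O => t
  | S O => - cos t
  | S (S p) => (INR (S p) * sin_pow_prim p t - cos t * sin t ^ S p) / INR (S (S p))
  end.

Lemma is_derive_sin_pow_prim n t : is_derive (sin_pow_prim n) t (sin t ^ n).
Proof.
assert (H : is_derive (sin_pow_prim n) t (sin t ^ n) /\
            is_derive (sin_pow_prim (S n)) t (sin t ^ S n)); [|apply H].
induction n as [|n [IH1 IH2]]; split; try assumption.
- cbn [sin_pow_prim]. auto_derive; [trivial|]. simpl. ring.
- cbn [sin_pow_prim]. auto_derive; [trivial|]. simpl. ring.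
- change (is_derive (fun t => (INR (S n) * sin_pow_prim n t - cos t * sin t ^ S n)
                              * / INR (S (S n))) t (sin t ^ S (S n))).
  assert (Hn : INR (S (S n)) <> 0) by (apply not_0_INR; lia).
  evar_last.
  + apply (is_derive_scal_l (V := R_NormedModule)
      (fun t => INR (S n) * sin_pow_prim n t - cos t * sin t ^ S n)).
    apply @is_derive_minus; [apply is_derive_scal, IH1|].
    apply (is_derive_mult cos (fun t => sin t ^ S n)).
    * apply is_derive_cos.
    * apply is_derive_pow, is_derive_sin.
    * intros; apply Rmult_comm.
  + unfold minus, plus, opp, scal, mult; simpl; unfold mult.
    change (match n with O => 1 | S _ => INR n + 1 end) with (INR (S n)).
    change (Init.Nat.pred (S n)) with n.
    pose proof (sin2_cos2 t) as E. unfold Rsqr in E.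
    assert (E' : cos t * cos t = 1 - sin t * sin t) by lra.
    assert (E2 : INR (S (S n)) = INR (S n) + 1) by (now rewrite S_INR).
    simpl INR in Hn, E2. simpl INR.
    apply Rmult_eq_reg_r with (match n with O => 1 | S _ => INR n + 1 end + 1); [|exact Hn].
    rewrite Rmult_assoc, Rinv_l by exact Hn.
    set (a := match n with O => 1 | S _ => INR n + 1 end).
    set (q := sin t ^ n).
    transitivity (a * q + sin t * sin t * q - a * (cos t * cos t) * q); [simpl; ring|].
    rewrite E'. ring.
Qed.

(** The integral of [sin ^ n] over [[0, pi/2]]. *)
Definition wallis (n : nat) : R := sin_pow_prim n (PI / 2) - sin_pow_prim n 0.

Lemma wallis_rec n : INR (S (S n)) * wallis (S (S n)) = INR (S n) * wallis n.
Proof.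
unfold wallis. cbn [sin_pow_prim]. rewrite cos_PI2, sin_0, cos_0.
rewrite pow_i by lia. field. apply not_0_INR. lia.
Qed.

Lemma wallis_decr n : wallis (S n) <= wallis n.
Proof.
pose proof PI_RGT_0.
cut (sin_pow_prim n 0 - sin_pow_prim (S n) 0
     <= sin_pow_prim n (PI / 2) - sin_pow_prim (S n) (PI / 2)); [unfold wallis; lra|].
apply (derive_nonneg_le (fun t => sin_pow_prim n t - sin_pow_prim (S n) t)
  (fun t => sin t ^ n - sin t ^ S n)).
- lra.
- intros. apply @is_derive_minus; apply is_derive_sin_pow_prim.
- intros c Hc. assert (0 <= sin c) by (apply sin_ge_0; lra).
  pose proof (SIN_bound c). assert (0 <= sin c ^ n) by (now apply pow_le).
  simpl. nra.
Qed.

Lemma wallis_product n : INR (S n) * wallis n * wallis (S n) = PI / 2.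
Proof.
induction n as [|n IH].
- unfold wallis. cbn [sin_pow_prim]. rewrite cos_PI2, cos_0. simpl. lra.
- rewrite <- IH.
  transitivity (wallis (S n) * (INR (S (S n)) * wallis (S (S n)))); [ring|].
  rewrite wallis_rec. ring.
Qed.

Lemma wallis_even n :
  wallis (2 * n) * (2 ^ n * INR (fact n)) ^ 2 = PI / 2 * INR (fact (2 * n)).
Proof.
induction n as [|n IH].
- unfold wallis. simpl. ring.
- replace (2 * S n)%nat with (S (S (2 * n))) by lia.
  rewrite !fact_simpl, !mult_INR.
  assert (E := wallis_rec (2 * n)).
  replace (INR (S (S (2 * n)))) with (2 * INR (S n)) in *
    by (rewrite !S_INR, mult_INR; simpl; ring).
   transitivity ((2 * INR (S n) * wallis (S (S (2 * n)))) * (2 * INR (S n))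
     * (2 ^ n * INR (fact n)) ^ 2); [change (2 ^ S n) with (2 * 2 ^ n); ring|].
  rewrite E.
  transitivity (INR (S (2 * n)) * (2 * INR (S n)) *
    (wallis (2 * n) * (2 ^ n * INR (fact n)) ^ 2)); [ring|].
  rewrite IH. ring.
Qed.

Lemma fact_pos n : 0 < INR (fact n).
Proof. apply lt_0_INR, lt_O_fact. Qed.

Lemma wallis_even_pos n : 0 < wallis (2 * n).
Proof.
pose proof (wallis_even n) as E. pose proof PI_RGT_0.
pose proof (fact_pos (2 * n)) as H1. pose proof (fact_pos n) as H2.
assert (H3 : 0 < (2 ^ n * INR (fact n)) ^ 2).
{ apply pow_lt, Rmult_lt_0_compat; [apply pow_lt; lra|exact H2]. }
assert (0 < PI / 2 * INR (fact (2 * n))) by (apply Rmult_lt_0_compat; lra).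
nra.
Qed.

Definition stirling_seq (n : nat) : R :=
  ln (INR (fact n)) - (INR n + 1 / 2) * ln (INR n) + INR n.

(** [2 s_n - s_(2n)] is the logarithm of [4^n n!^2 / ((2n)! sqrt n)] up to a
    constant. By monotonicity of [wallis] and [wallis_product], the square of
    [wallis (2 n)] is close to [pi / (4 n)]. *)
Lemma stirling_wallis_bounds n :
  (1 <= n)%nat ->
  ln (2 * PI) <= 2 * (2 * stirling_seq n - stirling_seq (2 * n))
              <= ln (2 * PI) + / INR n.
Proof.
intros Hn. pose proof PI_RGT_0 as Hpi.
assert (Hx : 1 <= INR n) by (change 1 with (INR 1); now apply le_INR).
pose proof (fact_pos n) as Hf. pose proof (fact_pos (2 * n)) as Hf2.
pose proof (wallis_even_pos n) as HW.
set (x := INR n) in *. set (W := wallis (2 * n)) in *.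
assert (HU : W ^ 2 * (4 * x) <= PI).
{ pose proof (wallis_product (2 * n - 1)) as E.
  pose proof (wallis_decr (2 * n - 1)) as D.
  replace (S (2 * n - 1)) with (2 * n)%nat in * by lia. fold W in E, D.
  rewrite mult_INR in E. fold x in E. simpl (INR 2) in E. nra. }
assert (HL : PI <= W ^ 2 * (4 * x + 2)).
{ pose proof (wallis_product (2 * n)) as E.
  pose proof (wallis_decr (2 * n)) as D. fold W in E, D.
  rewrite S_INR, mult_INR in E. fold x in E. simpl (INR 2) in E.
  assert (H : ((1 + 1) * x + 1) * W * wallis (S (2 * n)) <= ((1 + 1) * x + 1) * W * W)
    by (apply Rmult_le_compat_l; [apply Rmult_le_pos|]; lra).
  lra. }
assert (E1 : ln W + 2 * (INR n * ln 2 + ln (INR (fact n)))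
             = ln (PI / 2) + ln (INR (fact (2 * n)))).
{ assert (H2 : 0 < 2 ^ n) by (apply pow_lt; lra).
  assert (H3 : 0 < 2 ^ n * INR (fact n)) by (apply Rmult_lt_0_compat; lra).
  pose proof (f_equal ln (wallis_even n)) as E. fold W in E.
  rewrite ln_mult in E by (try apply pow_lt; lra).
  rewrite ln_pow, (ln_mult (2 ^ n)), ln_pow, ln_mult in E by lra.
  exact E. }
fold x in E1.
assert (E2 : 2 * (2 * stirling_seq n - stirling_seq (2 * n))
             = 2 * ln (PI / 2) + ln 2 - 2 * ln W - ln x).
{ unfold stirling_seq. rewrite mult_INR. fold x. simpl (INR 2).
  replace (1 + 1) with 2 by ring. rewrite (ln_mult 2 x) by lra.
  replace (ln (INR (fact (2 * n)))) with
    (ln W + 2 * (x * ln 2 + ln (INR (fact n))) - ln (PI / 2)) by lra.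
  field. }
rewrite E2.
assert (HW2 : 0 < W ^ 2) by (now apply pow_lt).
assert (E3 : ln (W ^ 2 * (4 * x)) = 2 * ln W + ln 4 + ln x).
{ rewrite !ln_mult, ln_pow by lra. simpl INR. ring. }
assert (HU' : ln (W ^ 2 * (4 * x)) <= ln PI).
{ apply ln_le; [apply Rmult_lt_0_compat; lra|exact HU]. }
assert (Hix : 0 < / x) by (apply Rinv_0_lt_compat; lra).
assert (HL' : ln PI <= ln (W ^ 2 * (4 * x)) + / x).
{ rewrite <- (ln_exp (/ x)), <- ln_mult
    by (try apply exp_pos; apply Rmult_lt_0_compat; lra).
  apply ln_le; [lra|]. eapply Rle_trans; [exact HL|].
  apply Rle_trans with (W ^ 2 * (4 * x) * (1 + / x)).
  - replace (W ^ 2 * (4 * x) * (1 + / x)) with (W ^ 2 * (4 * x + 4)) by (field; lra).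
    nra.
  - apply Rmult_le_compat_l; [apply Rmult_le_pos; lra|].
    left. apply exp_ineq1. lra. }
assert (E4 : ln 4 = 2 * ln 2).
{ replace 4 with (2 * 2) by ring. rewrite ln_mult by lra. ring. }
assert (EP : ln (PI / 2) = ln PI - ln 2) by (apply ln_div; lra).
rewrite EP, ln_mult by lra. lra.
Qed.

Lemma midpoint_log_sum_fact n :
  midpoint_log_sum (RtoC (1 / 2)) n = RtoC (ln (INR (fact n))).
Proof.
induction n as [|n IH]; cbn [midpoint_log_sum].
- simpl. now rewrite ln_1.
- rewrite IH, <- !RtoC_plus. replace (1 / 2 + INR n + 1 / 2) with (INR (S n))
    by (rewrite S_INR; field).
  assert (Hp : 0 < INR (S n)) by (apply lt_0_INR; lia).
  replace (Clog (RtoC (INR (S n)))) with (RtoC (ln (INR (S n)))).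
  + rewrite <- RtoC_plus, fact_simpl, mult_INR, ln_mult by (trivial; apply fact_pos).
    f_equal. ring.
  + unfold Clog, Carg. rewrite Cmod_R, Rabs_pos_eq by lra. simpl Im.
    unfold Rdiv. rewrite Rmult_0_l, atan_0, Rmult_0_r. reflexivity.
Qed.

(** At [z = 1/2] the midpoint sums are logarithms of factorials, so that the
    convergence of [euler_remainder] gives a limit [c]. As [2 s_n - s_(2n)] also
    tends to [c], Wallis's product identifies it. *)
Lemma stirling_seq_limit : is_lim_seq stirling_seq (1 / 2 * ln (2 * PI)).
Proof.
assert (Hc : exists c : R, is_lim_seq stirling_seq c).
{ destruct (euler_remainder_converges 1 (RtoC (1 / 2)) 1) as [l [Hl _]];
    [lia|simpl; lra| |lra|simpl; lra|].
  { intros E. apply RtoC_inj in E. lra. }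
  assert (HW := is_lim_seq_wlogw (RtoC (1 / 2))).
  assert (HT := is_lim_seq_T_hat_sum 1 (RtoC (1 / 2)) ltac:(simpl; lra)).
  assert (H := is_lim_seqC_minus _ _ _ _
     (is_lim_seqC_plus _ _ _ _ (is_lim_seqC_incr_1 _ _ HW) HT)
     (is_lim_seqC_plus _ _ _ _ (is_lim_seqC_incr_1 _ _ Hl)
        (is_lim_seqC_const (stirling_main 1 (RtoC (1 / 2)))))).
  set (L := (_ - _)%C) in H. exists (Re L).
  apply is_lim_seq_incr_1. destruct H as [H _].
  eapply is_lim_seq_ext; [|exact H]. intros n. cbv beta.
  unfold euler_remainder. rewrite midpoint_log_sum_fact. unfold stirling_main at 1.
  set (T := sum_n_m _ _ _). set (M := stirling_main _ _). set (N := INR (S n)).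
  unfold stirling_seq. fold N. set (lw := Clog _). clearbody lw T M.
  simpl. unfold Re. simpl. ring. }
destruct Hc as [c Hc].
assert (H2 : is_lim_seq (fun n => 2 * (2 * stirling_seq n - stirling_seq (2 * n)))
                        (2 * (2 * c - c))).
{ apply (is_lim_seq_scal_l _ 2 (2 * c - c)). apply is_lim_seq_minus'.
  - apply (is_lim_seq_scal_l _ 2 c Hc).
  - apply (is_lim_seq_subseq stirling_seq c (fun n => (2 * n)%nat)); [|exact Hc].
    apply eventually_subseq. intros n; lia. }
assert (H3 : is_lim_seq (fun n => 2 * (2 * stirling_seq n - stirling_seq (2 * n)))
                        (ln (2 * PI))).
{ apply is_lim_seq_le_le_loc with (fun _ => ln (2 * PI)) (fun n => ln (2 * PI) + / INR n).
  - exists 1%nat. intros n Hn. now apply stirling_wallis_bounds.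
  - apply is_lim_seq_const.
  - replace (Finite (ln (2 * PI))) with (Finite (ln (2 * PI) + 0)) by (f_equal; ring).
    apply is_lim_seq_plus'; [apply is_lim_seq_const|apply is_lim_seq_inv_INR]. }
assert (E : Finite (2 * (2 * c - c)) = Finite (ln (2 * PI))).
{ rewrite <- (is_lim_seq_unique _ _ H2). now apply is_lim_seq_unique. }
injection E as E. replace (1 / 2 * ln (2 * PI)) with c by lra. exact Hc.
Qed.

(** * The branch of ln Gamma *)

(** A logarithm of the [n]-th Gauss quotient at [z + 1/2]. *)
Definition log_gauss (z : C) (n : nat) : C :=
  (RtoC (ln (INR (fact n))) + (z + RtoC (1 / 2)) * RtoC (ln (INR n))
   - midpoint_log_sum z (S n))%C.

Lemma log_gauss_limit (z : C) m l :
  0 <= Re z -> is_lim_seqC (euler_remainder m z) l ->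
  is_lim_seqC (log_gauss z) (RtoC (1 / 2 * ln (2 * PI)) + stirling_main m z + l)%C.
Proof.
intros Hz Hl.
assert (HW := is_lim_seq_wlogw (z + 1)%C).
assert (HT := is_lim_seq_T_hat_sum m z Hz).
assert (HS := is_lim_seqC_real _ _ stirling_seq_limit).
assert (H := is_lim_seqC_plus _ _ _ _ (is_lim_seqC_minus _ _ _ _ HS
    (is_lim_seqC_plus _ _ _ _ HW HT))
  (is_lim_seqC_plus _ _ _ _ (is_lim_seqC_incr_1 _ _ Hl)
        (is_lim_seqC_const (stirling_main m z)))).
match type of H with is_lim_seqC _ ?L =>
  replace (RtoC (1 / 2 * ln (2 * PI)) + stirling_main m z + l)%C with L by ring end.
eapply is_lim_seqC_ext; [|exact H]. intros n. cbv beta.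
unfold log_gauss, euler_remainder, stirling_seq. unfold stirling_main at 1.
replace (z + 1 + RtoC (INR n))%C with (z + RtoC (INR (S n)))%C
  by (rewrite S_INR, RtoC_plus; ring).
set (T := sum_n_m _ _ _). set (M := stirling_main _ _). set (S0 := midpoint_log_sum _ _).
set (lw := Clog _).
rewrite S_INR, !RtoC_plus, !RtoC_minus, RtoC_mult, RtoC_plus.
assert (Eh : RtoC 1 = (RtoC (1 / 2) + RtoC (1 / 2))%C)
  by (rewrite <- RtoC_plus; f_equal; field).
rewrite Eh. ring.
Qed.

Lemma Cexp_plus a b : Cexp (a + b) = (Cexp a * Cexp b)%C.
Proof.
unfold Cexp, Cmult. simpl. unfold Re, Im. rewrite exp_plus, cos_plus, sin_plus.
f_equal; ring.
Qed.

Lemma Cexp_real (x : R) : Cexp (RtoC x) = RtoC (exp x).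
Proof. unfold Cexp, RtoC. simpl. rewrite cos_0, sin_0. f_equal; ring. Qed.

Lemma Cexp_neq_0 a : Cexp a <> 0%C.
Proof.
intros E. assert (H : (Cexp a * Cexp (- a) = 1)%C).
{ rewrite <- Cexp_plus. replace (a + - a)%C with (RtoC 0) by ring.
  now rewrite Cexp_real, exp_0. }
rewrite E, Cmult_0_l in H. apply RtoC_inj in H. lra.
Qed.

Lemma Cexp_minus a b : Cexp (a - b) = (Cexp a / Cexp b)%C.
Proof.
replace (Cexp a) with (Cexp (a - b) * Cexp b)%C
  by (rewrite <- Cexp_plus; f_equal; ring).
field. apply Cexp_neq_0.
Qed.

Lemma Cexp_midpoint_log_sum z n :
  slit_plane z ->
  Cexp (midpoint_log_sum z n) = rising_factorial (z + RtoC (1 / 2))%C n.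
Proof.
intros Hz. induction n as [|n IH]; cbn [midpoint_log_sum rising_factorial].
- now rewrite Cexp_real, exp_0.
- rewrite Cexp_plus, IH. f_equal.
  replace (z + RtoC (INR n) + RtoC (1 / 2))%C with (z + RtoC (INR n + 1 / 2))%C
    by (rewrite RtoC_plus; ring).
  rewrite (proj1 (Clog_spec _ (slit_plane_shift z (INR n + 1 / 2) Hz
      ltac:(pose proof (pos_INR n); lra)))).
  rewrite RtoC_plus. ring.
Qed.

Lemma Cexp_log_gauss z n :
  slit_plane z -> Cexp (log_gauss z n) = Gauss_Gamma_seq (z + RtoC (1 / 2))%C n.
Proof.
intros Hz. unfold log_gauss, Gauss_Gamma_seq.
rewrite Cexp_minus, Cexp_plus, Cexp_midpoint_log_sum by exact Hz.
rewrite Cexp_real, exp_ln by apply fact_pos. reflexivity.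
Qed.

Lemma Cexp_log_gauss_limit z l :
  slit_plane z -> is_lim_seqC (log_gauss z) l -> Cexp l = CGamma (z + RtoC (1 / 2))%C.
Proof.
intros Hz [H1 H2].
assert (He := is_lim_seq_continuous exp _ _
  (derivable_continuous_pt _ _ (derivable_pt_exp (Re l))) H1).
assert (Hc := is_lim_seq_continuous cos _ _ (continuity_cos (Im l)) H2).
assert (Hs := is_lim_seq_continuous sin _ _ (continuity_sin (Im l)) H2).
unfold CGamma, Cexp. f_equal; symmetry.
- apply (f_equal real (y := Finite (exp (Re l) * cos (Im l)))).
  apply is_lim_seq_unique.
  eapply is_lim_seq_ext; [|apply is_lim_seq_mult'; [exact He|exact Hc]].
  intros n. cbv beta. now rewrite <- Cexp_log_gauss.
- apply (f_equal real (y := Finite (exp (Re l) * sin (Im l)))).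
  apply is_lim_seq_unique.
  eapply is_lim_seq_ext; [|apply is_lim_seq_mult'; [exact He|exact Hs]].
  intros n. cbv beta. now rewrite <- Cexp_log_gauss.
Qed.

Lemma real_in_slit_plane (x : R) : 0 < x -> slit_plane (RtoC x).
Proof. intros H. left. exact H. Qed.

Lemma Im_midpoint_log_sum_real (x : R) n : 0 < x -> Im (midpoint_log_sum (RtoC x) n) = 0.
Proof.
intros Hx. induction n as [|n IH]; [reflexivity|].
cbn [midpoint_log_sum].
transitivity (Im (midpoint_log_sum (RtoC x) n)
              + Im (Clog (RtoC x + RtoC (INR n) + RtoC (1 / 2)))); [reflexivity|].
rewrite IH, <- !RtoC_plus. simpl. unfold Carg. simpl.
unfold Rdiv. rewrite Rmult_0_l, atan_0. ring.
Qed.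

Lemma cos_eq_1_small d : cos d = 1 -> Rabs d < 2 * PI -> d = 0.
Proof.
intros Hc Hd.
assert (Hpos : forall e, cos e = 1 -> 0 < e -> e < 2 * PI -> False).
{ intros e He H0 H1. replace e with (2 * (e / 2)) in He by field.
  rewrite cos_2a_sin in He.
  pose proof (sin_gt_0 (e / 2) ltac:(lra) ltac:(lra)). nra. }
apply Rabs_lt_between in Hd.
destruct (Rtotal_order d 0) as [H|[H|H]]; [|exact H|].
- exfalso. apply (Hpos (- d)); try lra. now rewrite cos_neg.
- exfalso. apply (Hpos d); trivial. lra.
Qed.

Lemma Cexp_eq a b : Cexp a = Cexp b -> Re a = Re b /\ cos (Im a - Im b) = 1.
Proof.
intros E.
assert (H : Cexp (a - b) = RtoC 1).
{ rewrite Cexp_minus, E. field. apply Cexp_neq_0. }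
injection H as H1 H2.
set (x := fst a + - fst b) in *. set (y := snd a + - snd b) in *.
pose proof (exp_pos x) as Hx.
assert (Hs : sin y = 0) by nra.
pose proof (sin2_cos2 y) as Hy. rewrite Hs in Hy. unfold Rsqr in Hy.
assert (Hcp : 0 < cos y) by nra.
assert (Hc : cos y = 1) by nra.
assert (He : exp x = 1) by nra.
split.
- assert (x = 0) by (rewrite <- (ln_exp x), He; apply ln_1).
  unfold Re, x in *. lra.
- exact Hc.
Qed.

Lemma remainder_bound_1 r : 0 < r -> remainder_bound 1 r 1 <= / 4 / r.
Proof.
intros Hr. unfold remainder_bound.
pose proof PI2_3_2 as H3. pose proof PI_4 as H4.
destruct (bern_half_abs 1 ltac:(lia)) as [_ H].
set (b := Rabs (bern (2 * 1) (1 / 2))) in *.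
assert (Hb : b <= 1 / 18).
{ eapply Rle_trans; [exact H|]. simpl (_ ^ _).
  apply Rle_div_l; nra. }
assert (Hb0 : 0 <= b) by apply Rabs_pos.
rewrite eta_pow by lia. simpl.
replace (1 / (1 - 2 * (1 / 4 * 1)) * b * (1 / (r * 1 * 1) * (PI / 2))) with (b * PI * / r)
  by (field; lra).
unfold Rdiv. apply Rmult_le_compat_r; [apply Rlt_le, Rinv_0_lt_compat, Hr|].
nra.
Qed.

Lemma Cmod_T_hat_1 (w : C) : w <> 0%C -> Cmod (T_hat 1 w) <= / 18 / Cmod w.
Proof.
intros Hw. rewrite Cmod_T_hat by (trivial; lia).
assert (Hr : 0 < Cmod w) by (now apply Cmod_gt_0).
destruct (bern_half_abs 1 ltac:(lia)) as [_ H]. pose proof PI2_3_2 as H3.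
set (b := Rabs (bern (2 * 1) (1 / 2))) in *.
assert (Hb : b <= 1 / 18).
{ eapply Rle_trans; [exact H|]. simpl (_ ^ _).
  apply Rle_div_l; nra. }
simpl. rewrite !Rmult_1_r. unfold Rdiv.
apply Rmult_le_compat_r; [apply Rlt_le, Rinv_0_lt_compat, Hr|lra].
Qed.

(** The first-order approximation [z Log z - z + ln (2 pi) / 2] is within 1, less
    than half of [2 pi], of the limit; this is enough to tell the branches of the
    logarithm apart. *)
Lemma log_gauss_near (z : C) :
  0 <= Re z -> 1 / 2 <= Cmod z -> exists l,
  is_lim_seqC (log_gauss z) l /\
  Cmod (l - RtoC (1 / 2 * ln (2 * PI)) - (z * Clog z - z))%C < 1.
Proof.
intros Hz Hr.
assert (H0 : z <> 0%C) by (apply Cmod_gt_0; lra).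
destruct (euler_remainder_converges 1 z 1) as [l [Hl Hb]];
  [lia|exact Hz|exact H0|lra|simpl; lra|].
exists (RtoC (1 / 2 * ln (2 * PI)) + stirling_main 1 z + l)%C. split.
- now apply log_gauss_limit with (m := 1%nat).
- unfold stirling_main. rewrite sum_n_m_T_hat_S, sum_n_m_zero by lia.
  change (zero : C) with (RtoC 0).
  match goal with |- Cmod ?e < _ => replace e with (T_hat 1 z + l)%C by ring end.
  eapply Rle_lt_trans; [apply Cmod_triangle|].
  pose proof (Cmod_T_hat_1 z H0) as H1.
  pose proof (remainder_bound_1 (Cmod z) ltac:(lra)) as H2.
  assert (Hi : / Cmod z <= 2).
  { replace 2 with (/ (1 / 2)) by field. apply Rinv_le_contravar; lra. }
  unfold Rdiv in *. lra.
Qed.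

Section Branch.

Variables (f : C -> C) (Hf : is_lnGamma f).

Lemma lnGamma_real_log_gauss (x : R) (l : C) :
  0 < x -> is_lim_seqC (log_gauss (RtoC x)) l -> f (RtoC x + RtoC (1 / 2))%C = l.
Proof.
intros Hx Hl.
assert (Hi : Im l = 0).
{ destruct Hl as [_ H].
  assert (H' : is_lim_seq (fun _ => 0) (Im l)).
  { eapply is_lim_seq_ext; [|exact H]. intros n. cbv beta.
    unfold log_gauss.
    transitivity (0 - Im (midpoint_log_sum (RtoC x) (S n)));
      [|rewrite Im_midpoint_log_sum_real by exact Hx; ring].
    set (s := midpoint_log_sum _ _). clearbody s. unfold Im. simpl. ring. }
  apply is_lim_seq_unique in H'. rewrite Lim_seq_const in H'.
  injection H' as H'. now symmetry. }
destruct Hf as [_ [_ Hr]].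
rewrite <- RtoC_plus, Hr by lra.
rewrite RtoC_plus.
rewrite <- (Cexp_log_gauss_limit (RtoC x) l (real_in_slit_plane x Hx) Hl).
destruct l as [a b]. simpl in Hi. subst b.
unfold Cexp; simpl. rewrite cos_0, Rmult_1_r, ln_exp. reflexivity.
Qed.

Lemma lnGamma_continuous (x y : R -> R) t :
  continuous x t -> continuous y t -> slit_plane (x t, y t) ->
  continuous (fun s => Im (f (x s, y s))) t.
Proof.
intros Hx Hy Hs.
destruct Hf as [Hd _].
assert (Hc := ex_derive_continuous f _ (Hd _ Hs)).
apply (continuous_comp (fun s => f (x s, y s)) (fun w : C => snd w)).
- apply (continuous_comp_2 x y (fun a b => f (a, b))); trivial.
  apply (continuous_ext (f : C_UniformSpace -> C_UniformSpace));
    [intros [a b]; reflexivity|].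
  intros P HP. apply (proj2 (locally_C _ _)), Hc, HP.
- apply continuous_snd.
Qed.

(** A parametrisation of the segment from [|z|] to [z]; when [Re z >= 0] and
    [|z| >= 1] it keeps a distance of at least 1/2 from 0. *)
Definition seg_re (z : C) (t : R) : R := Cmod z + t * (Re z - Cmod z).
Definition seg_im (z : C) (t : R) : R := t * Im z.

Lemma seg_Re_nonneg z t : 0 <= Re z -> 0 <= t <= 1 -> 0 <= seg_re z t.
Proof.
intros H Ht. unfold seg_re. pose proof (Cmod_ge_0 z) as Hr.
pose proof (Rmult_le_pos t (Re z) ltac:(lra) H).
pose proof (Rmult_le_pos (1 - t) (Cmod z) ltac:(lra) Hr). lra.
Qed.

Lemma seg_Cmod z t :
  0 <= Re z -> 1 <= Cmod z -> 0 <= t <= 1 -> 1 / 2 <= Cmod (seg_re z t, seg_im z t).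
Proof.
intros H H1 Ht.
assert (E : Cmod (seg_re z t, seg_im z t) ^ 2
  = (1 - t) ^ 2 * Cmod z ^ 2 + 2 * t * (1 - t) * Cmod z * Re z + t ^ 2 * Cmod z ^ 2).
{ rewrite !(Cmod2_alt (_, _)). unfold seg_re, seg_im.
  pose proof (Cmod2_alt z) as E. simpl Re. simpl Im.
  replace (t ^ 2 * Cmod z ^ 2) with (t ^ 2 * (Re z ^ 2 + Im z ^ 2)) by (now rewrite <- E).
  ring. }
set (r := Cmod z) in *. set (q := Cmod (seg_re z t, seg_im z t)) in *.
assert (Hq : 0 <= q) by apply Cmod_ge_0.
assert (0 <= 2 * t * (1 - t) * r * Re z).
{ repeat apply Rmult_le_pos; lra. }
assert (1 / 2 <= (1 - t) ^ 2 + t ^ 2) by (pose proof (pow2_ge_0 (2 * t - 1)); lra).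
assert (1 <= r ^ 2) by nra.
assert (1 / 2 <= ((1 - t) ^ 2 + t ^ 2) * r ^ 2) by nra.
nra.
Qed.

(** The imaginary part of [f (w + 1/2) - (w Log w - w)] along the segment, spelled
    out in real functions so that its continuity can be computed. *)
Definition branch_gap (z : C) (t : R) : R :=
  Im (f (seg_re z t + 1 / 2, seg_im z t))
  - (seg_im z t * ln (sqrt (seg_re z t ^ 2 + seg_im z t ^ 2))
     + seg_re z t * (2 * atan (seg_im z t
            / (sqrt (seg_re z t ^ 2 + seg_im z t ^ 2) + seg_re z t)))
     - seg_im z t).

Lemma branch_gap_continuous z t :
  0 <= Re z -> 1 <= Cmod z -> 0 <= t <= 1 -> continuity_pt (branch_gap z) t.
Proof.
intros H H1 Ht.
pose proof (seg_Re_nonneg z t H Ht) as Hx. pose proof (seg_Cmod z t H H1 Ht) as Hq.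
apply continuity_pt_filterlim.
apply (continuous_minus (V := R_NormedModule)).
- apply (lnGamma_continuous (fun t => seg_re z t + 1 / 2) (seg_im z)).
  + apply (ex_derive_continuous (V := R_NormedModule)). unfold seg_re. auto_derive. trivial.
  + apply (ex_derive_continuous (V := R_NormedModule)). unfold seg_im. auto_derive. trivial.
  + left. simpl. lra.
- apply (ex_derive_continuous (V := R_NormedModule)).
  unfold Cmod in Hq. simpl fst in Hq. simpl snd in Hq.
  set (x := seg_re z t) in *. set (y := seg_im z t) in *.
  assert (0 < x ^ 2 + y ^ 2).
  { destruct (Rlt_or_le 0 (x ^ 2 + y ^ 2)); [trivial|].
    rewrite sqrt_neg_0 in Hq by trivial. lra. }
  unfold seg_re, seg_im. auto_derive.
  change (Cmod z + t * (Re z - Cmod z)) with x. change (t * Im z) with y.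
  replace (x * (x * 1) + y * (y * 1)) with (x ^ 2 + y ^ 2) by ring.
  repeat split; trivial; lra.
Qed.

Lemma branch_gap_alt z t (w := (seg_re z t, seg_im z t) : C) :
  branch_gap z t = Im (f (w + RtoC (1 / 2)) - (w * Clog w - w))%C.
Proof.
unfold branch_gap, w.
replace ((seg_re z t, seg_im z t) + RtoC (1 / 2))%C with (seg_re z t + 1 / 2, seg_im z t)
  by (unfold Cplus, RtoC; simpl; f_equal; ring).
unfold Clog, Carg, Cmod. simpl. unfold Im; simpl. ring.
Qed.

(** [d] is the discrepancy between [f] and the limit of [log_gauss], a multiple of
    [2 pi]. *)
Lemma branch_gap_value z t :
  0 <= Re z -> 1 <= Cmod z -> 0 <= t <= 1 ->
  exists d, cos d = 1 /\ Rabs (branch_gap z t - d) < 1.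
Proof.
intros H H1 Ht.
pose proof (seg_Re_nonneg z t H Ht) as Hx. pose proof (seg_Cmod z t H H1 Ht) as Hq.
rewrite branch_gap_alt.
set (w := (seg_re z t, seg_im z t) : C) in *.
destruct (log_gauss_near w Hx Hq) as [l [Hl Hn]].
assert (Hw : slit_plane w).
{ apply Re_nonneg_slit_plane; [exact Hx|]. apply Cmod_gt_0. lra. }
exists (Im (f (w + RtoC (1 / 2)))%C - Im l). split.
- apply (Cexp_eq (f (w + RtoC (1 / 2))%C) l).
  rewrite (Cexp_log_gauss_limit w l Hw Hl). apply (proj1 (proj2 Hf)).
  apply slit_plane_shift; [exact Hw|lra].
- eapply Rle_lt_trans; [|exact Hn]. eapply Rle_trans; [|apply Rabs_le_between, Im_le_Cmod].
  apply Req_le. f_equal. simpl. unfold Im. simpl. ring.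
Qed.

(** [branch_gap] is continuous, starts in (-2, 2) because [f] is real on the positive
    axis, and never takes the values 2 and -2. So it ends in (-2, 2), where 0 is the
    only multiple of [2 pi] within reach. *)
Theorem lnGamma_log_gauss (z l : C) :
  0 <= Re z -> 1 <= Cmod z -> is_lim_seqC (log_gauss z) l ->
  f (z + RtoC (1 / 2))%C = l.
Proof.
intros H H1 Hl. pose proof PI2_3_2 as Hpi.
assert (Hz : slit_plane z) by (apply Re_nonneg_slit_plane; [exact H|apply Cmod_gt_0; lra]).
assert (H0 : Rabs (branch_gap z 0) < 2).
{ rewrite branch_gap_alt.
  replace (seg_re z 0, seg_im z 0) with (RtoC (Cmod z))
    by (unfold seg_re, seg_im, RtoC; f_equal; ring).
  destruct (log_gauss_near (RtoC (Cmod z))) as [l0 [Hl0 Hn0]].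
  - simpl. lra.
  - rewrite Cmod_R, Rabs_pos_eq; lra.
  - rewrite (lnGamma_real_log_gauss _ l0) by (trivial; lra).
    set (p := (RtoC (Cmod z) * Clog (RtoC (Cmod z)) - RtoC (Cmod z))%C) in *.
    replace (Im (l0 - p)%C) with (Im (l0 - RtoC (1 / 2 * ln (2 * PI)) - p)%C)
      by (simpl; unfold Im; simpl; ring).
    eapply Rle_lt_trans; [apply Rabs_le_between, Im_le_Cmod|]. lra. }
(* the gap stays within 1 of a multiple of 2 pi, hence never equals 2 or -2 *)
assert (Hne : forall t, 0 <= t <= 1 -> Rabs (branch_gap z t) <> 2).
{ intros t Ht E. destruct (branch_gap_value z t H H1 Ht) as [d [Hd Hg]].
  assert (d = 0).
  { apply cos_eq_1_small; [exact Hd|].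
    revert E Hg. unfold Rabs. repeat destruct Rcase_abs; lra. }
  subst d. rewrite Rminus_0_r, E in Hg. lra. }
assert (H2 : Rabs (branch_gap z 1) < 2).
{ apply Rnot_le_lt. intros Hge.
  destruct (Ranalysis5.IVT_interv (fun t => Rabs (branch_gap z t) - 2) 0 1) as [t [Ht E]].
  - intros t Ht. apply continuity_pt_minus.
    + apply (continuity_pt_comp (branch_gap z) Rabs).
      * now apply branch_gap_continuous.
      * apply Rcontinuity_abs.
    + apply continuity_pt_const. intros a b. reflexivity.
  - lra.
  - lra.
  - pose proof (Hne 1 ltac:(lra)). lra.
  - apply (Hne t Ht). lra. }
assert (E1 : (seg_re z 1, seg_im z 1) = z).
{ destruct z as [x y]. unfold seg_re, seg_im. simpl. f_equal; ring. }
rewrite branch_gap_alt, E1 in H2.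
destruct (log_gauss_near z H ltac:(lra)) as [l' [Hl' Hn]].
assert (l' = l).
{ destruct Hl as [A1 A2], Hl' as [B1 B2].
  apply is_lim_seq_unique in A1. apply is_lim_seq_unique in A2.
  apply is_lim_seq_unique in B1. apply is_lim_seq_unique in B2.
  rewrite A1 in B1. rewrite A2 in B2. injection B1 as B1. injection B2 as B2.
  destruct l, l'. simpl in *. congruence. }
subst l'.
destruct (Cexp_eq (f (z + RtoC (1 / 2))%C) l) as [ER EI].
{ rewrite (Cexp_log_gauss_limit z l Hz Hl). apply (proj1 (proj2 Hf)).
  apply slit_plane_shift; [exact Hz|lra]. }
apply cos_eq_1_small in EI.
- set (a := f (z + RtoC (1 / 2))%C) in *. destruct a as [a1 a2], l as [l1 l2].
  simpl in ER, EI. f_equal; [exact ER|lra].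
- set (a := f (z + RtoC (1 / 2))%C) in *.
  set (p := (z * Clog z - z)%C) in *.
  pose proof (Im_le_Cmod (l - RtoC (1 / 2 * ln (2 * PI)) - p)%C) as H3.
  apply Rabs_lt_between in H2. apply Rabs_lt_between.
  clearbody a p. unfold Im in *. simpl in *. lra.
Qed.

End Branch.

(** * Numerical estimate of the tail *)

Lemma PI_bounds : 31415 / 10000 < PI < 31416 / 10000.
Proof.
pose proof (PI_2_3_7_ineq 3) as [H1 H2].
unfold tg_alt, PI_2_3_7_tg, Ratan_seq in H1, H2. simpl in H1, H2.
split; lra.
Qed.

Lemma PI_sqr_bounds : 9869 / 1000 < PI ^ 2 < 98697 / 10000.
Proof. pose proof PI_bounds. split; nra. Qed.

Lemma eta_le m : (1 <= m)%nat -> eta m <= 1 + 4 * (1 / 4) ^ m.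
Proof.
intros Hm. rewrite eta_pow by exact Hm. pose proof (pow_half_le m Hm).
apply Rle_div_l; [lra|]. nra.
Qed.

Lemma target_ge k :
  (1 <= k)%nat ->
  1 + (1 / 4) ^ k + 2 * ((1 / 4) ^ k) ^ 2 <= (1 - (1 / 4) ^ k) * eta k.
Proof.
intros Hk. rewrite eta_pow by exact Hk. pose proof (pow_half_le k Hk).
set (a := (1 / 4) ^ k) in *.
replace ((1 - a) * (1 / (1 - 2 * a))) with ((1 - a) / (1 - 2 * a)) by (field; lra).
apply Rle_div_r; [lra|].
assert (0 <= a ^ 3) by (apply pow_le; lra). nra.
Qed.

Lemma pow2_ge_10_sqr n : (10 <= n)%nat -> 10 * INR n ^ 2 <= 2 ^ n.
Proof.
intros H. induction H as [|n Hn IH].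
- replace (INR 10) with 10 by (simpl; ring). lra.
- rewrite S_INR. change (2 ^ S n) with (2 * 2 ^ n).
  apply le_INR in Hn. replace (INR 10) with 10 in Hn by (simpl; ring). nra.
Qed.

Lemma pow2_ge_linear n : (6 <= n)%nat -> 8 * INR n <= 2 ^ n.
Proof.
intros H. induction H as [|n Hn IH]; [simpl; lra|].
rewrite S_INR. change (2 ^ S n) with (2 * 2 ^ n).
apply le_INR in Hn. simpl (INR 6) in Hn. lra.
Qed.

(** The growth factor from [j] to [j + 1] of the leading part of [T_hat j z], when
    [|z| = k], the extreme case of [k <= |z|]. *)
Definition ratio (k j : nat) : R :=
  INR j * (2 * INR j - 1) / (2 * INR k ^ 2) / PI ^ 2.

(** [Q j] stands for the size of [R_(j+1)] relative to the leading part of [T_j]. *)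
Section Tail.

Variables (k : nat) (Q : nat -> R).
Hypothesis Hk : (1 <= k)%nat.
Hypothesis HQ0 : forall j, 0 <= Q j.
Hypothesis Hstep : forall j, (k <= j)%nat -> Q j <= ratio k j * (1 + Q (S j)).
Hypothesis Hend : forall m s, (k <= m)%nat -> 0 < s -> s ^ 2 <= INR m ->
  Q m <= eta m * (2 * INR m - 1) * PI / (2 * s).

(** The bound of [Q (m - n)] that [n] uses of [Hstep] deduce from [Q m <= v]; the
    constant [1000 / 9869] is an upper bound of [1 / pi^2]. *)
Fixpoint descend (m n : nat) (v : R) : R :=
  match n with
  | O => v
  | S p => INR (m - S p) * (2 * INR (m - S p) - 1) / (2 * INR k ^ 2) * (1000 / 9869)
           * (1 + descend m p v)
  end.

Lemma INR_k_ge_1 : 1 <= INR k.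
Proof. change 1 with (INR 1). now apply le_INR. Qed.

Lemma descend_bound m n v :
  (k + n <= m)%nat -> Q m <= v -> Q (m - n)%nat <= descend m n v.
Proof.
intros Hm Hv. induction n as [|p IH].
- now rewrite Nat.sub_0_r.
- cbn [descend]. specialize (IH ltac:(lia)).
  eapply Rle_trans; [apply Hstep; lia|].
  replace (S (m - S p)) with (m - p)%nat by lia.
  pose proof INR_k_ge_1 as HK. pose proof PI_sqr_bounds as HP.
  assert (Hj : 1 <= INR (m - S p)).
  { change 1 with (INR 1). apply le_INR. lia. }
  set (x := INR (m - S p)) in *.
  unfold ratio. fold x.
  assert (0 <= x * (2 * x - 1) / (2 * INR k ^ 2)).
  { apply Rmult_le_pos; [nra|]. apply Rlt_le, Rinv_0_lt_compat.
    pose proof (pow_lt (INR k) 2 ltac:(lra)). lra. }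
  apply Rmult_le_compat.
  + apply Rmult_le_pos; [assumption|]. apply Rlt_le, Rinv_0_lt_compat. lra.
  + pose proof (HQ0 (m - p)). lra.
  + apply Rmult_le_compat_l; [assumption|].
    replace (1000 / 9869) with (/ (9869 / 1000)) by field.
    apply Rinv_le_contravar; lra.
  + lra.
Qed.

(** A lower bound of [(1 - (1/4)^k) eta_k / (pi^2 - 1)] whose numerator is polynomial
    in [(1/4)^k]. *)
Definition target : R :=
  (1 + (1 / 4) ^ k + 2 * ((1 / 4) ^ k) ^ 2) / (PI ^ 2 - 1).

Lemma tail_bound_descent m s :
  (k < m)%nat -> 0 < s -> s ^ 2 <= INR m ->
  descend m (m - k) ((1 + 4 * (1 / 4) ^ m) * (2 * INR m - 1) * (31416 / 10000) / (2 * s))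
    < (1 + (1 / 4) ^ k + 2 * ((1 / 4) ^ k) ^ 2) * (10000 / 88697) ->
  ratio k k * (1 + Q (S k)) < target.
Proof.
intros Hm Hs Hsm H.
pose proof PI_bounds as HP. pose proof PI_sqr_bounds as HP2. pose proof INR_k_ge_1 as HK.
assert (H4 : forall n, 0 <= (1 / 4) ^ n) by (intros; apply pow_le; lra).
assert (HM : 1 <= INR m) by (change 1 with (INR 1); apply le_INR; lia).
assert (Hv : Q m <= (1 + 4 * (1 / 4) ^ m) * (2 * INR m - 1) * (31416 / 10000) / (2 * s)).
{ eapply Rle_trans; [apply (Hend m s); trivial; lia|].
  apply Rmult_le_compat_r; [apply Rlt_le, Rinv_0_lt_compat; lra|].
  pose proof (eta_le m ltac:(lia)). pose proof (eta_ge_1 m ltac:(lia)).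
  apply Rmult_le_compat; [apply Rmult_le_pos; lra|lra|apply Rmult_le_compat; lra|lra]. }
assert (Hd := descend_bound m (m - S k) _ ltac:(lia) Hv).
replace (m - (m - S k))%nat with (S k) in Hd by lia.
replace (m - k)%nat with (S (m - S k)) in H by lia.
cbn [descend] in H.
replace (m - S (m - S k))%nat with k in H by lia.
set (d := descend m (m - S k) _) in *.
eapply Rle_lt_trans; [|eapply Rlt_le_trans; [exact H|]].
- unfold ratio.
  assert (0 <= INR k * (2 * INR k - 1) / (2 * INR k ^ 2)).
  { apply Rmult_le_pos; [nra|]. apply Rlt_le, Rinv_0_lt_compat.
    pose proof (pow_lt (INR k) 2 ltac:(lra)). lra. }
  pose proof (HQ0 (S k)).
  apply Rmult_le_compat.
  + apply Rmult_le_pos; [assumption|]. apply Rlt_le, Rinv_0_lt_compat. lra.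
  + lra.
  + apply Rmult_le_compat_l; [assumption|].
    replace (1000 / 9869) with (/ (9869 / 1000)) by field.
    apply Rinv_le_contravar; lra.
  + lra.
- unfold target. apply Rmult_le_compat_l.
  + pose proof (H4 k). pose proof (pow2_ge_0 ((1 / 4) ^ k)). lra.
  + replace (10000 / 88697) with (/ (88697 / 10000)) by field.
    apply Rinv_le_contravar; lra.
Qed.

(** A supersolution of the recurrence of [Hstep] from [k + 1] up to [2 k].
    [1 / (pi^2 - 1)] is the fixed point of [q = (1 + q) / pi^2], the recurrence with
    the ratio frozen at its value near [k]. The correction is of order [1 / k] near
    [k], to allow for the growth of the ratio, yet large enough at [2 k] to exceed
    the bound of [Hend]. *)
Definition envelope (i : nat) : R := / (PI ^ 2 - 1) + 2 ^ i / (4 * INR k).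

Lemma envelope_end : (10 <= k)%nat -> Q (2 * k)%nat <= envelope k.
Proof.
intros H. pose proof PI_bounds as HP. pose proof PI_sqr_bounds as HP2.
assert (HK : 10 <= INR k) by (replace 10 with (INR 10) by (simpl; ring); now apply le_INR).
eapply Rle_trans; [apply (Hend (2 * k) 3); [lia|lra|]|].
{ rewrite mult_INR. simpl (INR 2). lra. }
assert (He : eta (2 * k) <= 1 + 1 / 64).
{ eapply Rle_trans; [apply eta_le; lia|]. apply Rplus_le_compat_l.
  replace (2 * k)%nat with (4 + (2 * k - 4))%nat by lia. rewrite pow_add.
  pose proof (pow_incr (1 / 4) 1 (2 * k - 4) ltac:(lra)) as Hq. rewrite pow1 in Hq.
  lra. }
pose proof (eta_ge_1 (2 * k) ltac:(lia)) as He1.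
rewrite mult_INR. simpl (INR 2). set (x := INR k) in *.
unfold envelope. fold x.
assert (H2 : 5 / 2 * x <= 2 ^ k / (4 * x)).
{ apply (Rle_div_r (5 / 2 * x)); [lra|]. pose proof (pow2_ge_10_sqr k H) as Hp.
  fold x in Hp. lra. }
assert (0 < / (PI ^ 2 - 1)) by (apply Rinv_0_lt_compat; lra).
assert (eta (2 * k) * (2 * ((1 + 1) * x) - 1) * PI
        <= (1 + 1 / 64) * (4 * x) * (31416 / 10000)).
{ apply Rmult_le_compat; [apply Rmult_le_pos; lra|lra|apply Rmult_le_compat; lra|lra]. }
lra.
Qed.

(** Subtracting the fixed-point identity and dividing by [1 / k] leaves a polynomial
    inequality in [i], [2 ^ i] and [1 / k <= 1/10]. *)
Lemma envelope_step i :
  (10 <= k)%nat -> (1 <= i < k)%nat ->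
  ratio k (k + i) * (1 + envelope (S i)) <= envelope i.
Proof.
intros H Hi. pose proof PI_sqr_bounds as HP.
assert (HK : 10 <= INR k) by (replace 10 with (INR 10) by (simpl; ring); now apply le_INR).
assert (HI : 1 <= INR i <= INR k).
{ split; [change 1 with (INR 1); apply le_INR; lia|apply le_INR; lia]. }
unfold ratio, envelope. rewrite plus_INR. change (2 ^ S i) with (2 * 2 ^ i).
set (P := PI ^ 2) in *.
assert (Hy : 0 < / INR k <= 1 / 10).
{ split; [apply Rinv_0_lt_compat; lra|].
  replace (1 / 10) with (/ 10) by field. apply Rinv_le_contravar; lra. }
assert (Hxy : INR i * / INR k <= 1) by (apply Rle_div_l; lra).
replace ((INR k + INR i) * (2 * (INR k + INR i) - 1) / (2 * INR k ^ 2) / P)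
  with ((1 + (2 * INR i - 1 / 2) * / INR k + INR i * (INR i - 1 / 2) * (/ INR k) ^ 2) * / P)
  by (field; lra).
replace (2 ^ i / (4 * INR k)) with (2 ^ i * / INR k / 4) by (field; lra).
replace (2 * 2 ^ i / (4 * INR k)) with (2 ^ i * / INR k / 2) by (field; lra).
set (y := / INR k) in *. set (x := INR i) in *. set (p := 2 ^ i) in *.
(* dividing by y what is left once the constant terms cancel *)
cut ((2 * x - 1 / 2 + x * (x - 1 / 2) * y) * / (P - 1)
     + (1 + (2 * x - 1 / 2) * y + x * (x - 1 / 2) * y ^ 2) * / P * p / 2 <= p / 4).
{ intros Hc.
  transitivity (/ (P - 1) + y * ((2 * x - 1 / 2 + x * (x - 1 / 2) * y) * / (P - 1)
     + (1 + (2 * x - 1 / 2) * y + x * (x - 1 / 2) * y ^ 2) * / P * p / 2)).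
  - apply Req_le. field. lra.
  - replace (p * y / 4) with (y * (p / 4)) by field.
    apply Rplus_le_compat_l, Rmult_le_compat_l; lra. }
assert (HiP : 0 < / P <= 1000 / 9869).
{ split; [apply Rinv_0_lt_compat; lra|].
  replace (1000 / 9869) with (/ (9869 / 1000)) by field. apply Rinv_le_contravar; lra. }
assert (HiP1 : 0 < / (P - 1) <= 1000 / 8869).
{ split; [apply Rinv_0_lt_compat; lra|].
  replace (1000 / 8869) with (/ (8869 / 1000)) by field. apply Rinv_le_contravar; lra. }
assert (Hgen : forall a b : R, 2 * x - 1 / 2 + x * (x - 1 / 2) * y <= a ->
  1 + (2 * x - 1 / 2) * y + x * (x - 1 / 2) * y ^ 2 <= b -> 0 <= a -> 0 <= b -> 0 <= p ->
  a * (1000 / 8869) + b * (1000 / 9869) * p / 2 <= p / 4 ->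
  (2 * x - 1 / 2 + x * (x - 1 / 2) * y) * / (P - 1)
     + (1 + (2 * x - 1 / 2) * y + x * (x - 1 / 2) * y ^ 2) * / P * p / 2 <= p / 4).
{ intros a b Ha Hb Ha0 Hb0 Hp0 Hab. eapply Rle_trans; [|exact Hab].
  apply Rplus_le_compat.
  - apply Rle_trans with (a * / (P - 1)).
    + apply Rmult_le_compat_r; lra.
    + apply Rmult_le_compat_l; lra.
  - unfold Rdiv. rewrite !(Rmult_assoc _ p).
    apply Rmult_le_compat_r; [lra|].
    apply Rle_trans with (b * / P).
    + apply Rmult_le_compat_r; lra.
    + apply Rmult_le_compat_l; lra. }
assert (Hp0 : 0 <= p) by (apply pow_le; lra).
assert (Hy2 : 0 <= y ^ 2 <= 1 / 100) by nra.
destruct (Nat.le_gt_cases 6 i) as [L|L].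
- (* crude bounds suffice: p beats x *)
  pose proof (pow2_ge_linear i L) as Hpx. fold x p in Hpx.
  assert (Hxx : 0 <= x * y) by nra.
  apply (Hgen (3 * x) 4); trivial; try lra.
  + assert (x * (x - 1 / 2) * y <= x) by nra. lra.
  + assert (x * (x - 1 / 2) * y ^ 2 <= 1) by nra. lra.
- assert (Hc : (i = 1 \/ i = 2 \/ i = 3 \/ i = 4 \/ i = 5)%nat) by lia.
  set (a := 2 * x - 1 / 2 + x * (x - 1 / 2) * (1 / 10)).
  set (b := 1 + (2 * x - 1 / 2) * (1 / 10) + x * (x - 1 / 2) * (1 / 100)).
  apply (Hgen a b); trivial; unfold a, b, x, p;
  destruct Hc as [->|[->|[->|[->| ->]]]]; simpl in *; lra.
Qed.

Lemma envelope_bound i : (10 <= k)%nat -> (1 <= i <= k)%nat -> Q (k + i)%nat <= envelope i.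
Proof.
intros H Hi. replace i with (k - (k - i))%nat by lia.
assert (Hn : (k - i < k)%nat) by lia. revert Hn. generalize (k - i)%nat. clear i Hi.
induction n as [|n IH]; intros Hn.
- rewrite Nat.sub_0_r. replace (k + k)%nat with (2 * k)%nat by lia. now apply envelope_end.
- eapply Rle_trans; [apply Hstep; lia|].
  eapply Rle_trans; [|apply envelope_step; [exact H|lia]].
  replace (S (k + (k - S n))) with (k + (k - n))%nat by lia.
  replace (S (k - S n)) with (k - n)%nat by lia.
  apply Rmult_le_compat_l.
  + unfold ratio. pose proof PI_sqr_bounds as HP.
    assert (1 <= INR (k + (k - S n))) by (change 1 with (INR 1); apply le_INR; lia).
    pose proof (pow_lt (INR k) 2 ltac:(pose proof INR_k_ge_1; lra)).
    repeat apply Rmult_le_pos; try lra; apply Rlt_le, Rinv_0_lt_compat; lra.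
  + pose proof (IH ltac:(lia)). lra.
Qed.

(** The factor [1 - 1 / (2 k)] of [ratio k k] outweighs the correction
    [1 / (2 k)] in [envelope 1]. *)
Lemma tail_bound_envelope : (10 <= k)%nat -> ratio k k * (1 + Q (S k)) < target.
Proof.
intros H. pose proof (envelope_bound 1 H ltac:(lia)) as He.
replace (k + 1)%nat with (S k) in He by lia.
pose proof PI_sqr_bounds as HP. pose proof INR_k_ge_1 as HK.
unfold envelope in He. unfold target, ratio.
assert (Ha : 0 <= (1 / 4) ^ k) by (apply pow_le; lra).
set (a := (1 / 4) ^ k) in *. set (P := PI ^ 2) in *. set (x := INR k) in *.
assert (Hi : 0 < / (P - 1)) by (apply Rinv_0_lt_compat; lra).
assert (HiP : 0 < / P) by (apply Rinv_0_lt_compat; lra).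
assert (Hy : 0 < / x) by (apply Rinv_0_lt_compat; lra).
apply Rlt_le_trans with (/ (P - 1)).
2:{ unfold Rdiv. rewrite <- (Rmult_1_l (/ (P - 1))) at 1.
    apply Rmult_le_compat_r; [lra|]. pose proof (pow2_ge_0 a). lra. }
replace (x * (2 * x - 1) / (2 * x ^ 2) / P) with ((1 - / x / 2) * / P) by (field; lra).
assert (Hx1 : / x <= 1) by (rewrite <- Rinv_1; apply Rinv_le_contravar; lra).
apply Rle_lt_trans with ((1 - / x / 2) * / P * (1 + (/ (P - 1) + 2 ^ 1 / (4 * x)))).
{ apply Rmult_le_compat_l; [apply Rmult_le_pos; lra|lra]. }
replace ((1 - / x / 2) * / P * (1 + (/ (P - 1) + 2 ^ 1 / (4 * x))))
  with (/ (P - 1) - / x * / P * (/ (P - 1) / 2 + / x / 4)) by (field; lra).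
assert (0 < / x * / P * (/ (P - 1) / 2 + / x / 4)).
{ repeat apply Rmult_lt_0_compat; lra. }
lra.
Qed.

End Tail.

(** The margin decreases like [1 / k] relative to the bound. For large [k] the
    envelope is uniform; below 10 the recurrence is run numerically. *)
Lemma tail_bound (k : nat) (Q : nat -> R) :
  (1 <= k)%nat ->
  (forall j, 0 <= Q j) ->
  (forall j, (k <= j)%nat -> Q j <= ratio k j * (1 + Q (S j))) ->
  (forall m s, (k <= m)%nat -> 0 < s -> s ^ 2 <= INR m ->
     Q m <= eta m * (2 * INR m - 1) * PI / (2 * s)) ->
  ratio k k * (1 + Q (S k)) < (1 - (1 / 4) ^ k) * eta k / (PI ^ 2 - 1).
Proof.
intros Hk H0 Hs He.
apply Rlt_le_trans with (target k).
2:{ unfold target. apply Rmult_le_compat_r; [|now apply target_ge].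
    pose proof PI_sqr_bounds. apply Rlt_le, Rinv_0_lt_compat. lra. }
destruct (Nat.le_gt_cases 10 k) as [L|L]; [now apply tail_bound_envelope|].
assert (Hc : (k = 1 \/ k = 2 \/ k = 3 \/ k = 4 \/ k = 5 \/ k = 6 \/ k = 7 \/ k = 8
              \/ k = 9)%nat)
  by lia.
(* starting far enough from k for the factor sqrt m to be absorbed, but before the
   ratios exceed 1; s is a rational at most sqrt m *)
destruct Hc as [->|[->|Hc]].
- apply (tail_bound_descent 1 Q Hk H0 Hs He 4 2); [lia|lra|simpl; lra|simpl; lra].
- apply (tail_bound_descent 2 Q Hk H0 Hs He 6 (61 / 25)); [lia|lra|simpl; lra|simpl; lra].
- apply (tail_bound_descent k Q Hk H0 Hs He (k + 6) 3); [lia|lra| |].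
  + rewrite plus_INR. apply le_INR in Hk.
    assert (3 <= INR k) by (replace 3 with (INR 3) by (simpl; ring); apply le_INR; lia).
    simpl (INR 6). lra.
  + replace (k + 6 - k)%nat with 6%nat by lia.
    repeat destruct Hc as [->|Hc]; try subst k; simpl; lra.
Qed.

(** * The remainder relative to T_k *)

(** [s] replaces [sqrt m], which would be the best choice. *)
Lemma R_hat_bound (f : C -> C) (m : nat) (z : C) (s : R) :
  is_lnGamma f -> (1 <= m)%nat -> 0 <= Re z -> 1 <= Cmod z -> 0 < s -> s ^ 2 <= INR m ->
  Cmod (R_hat f (m + 1) z) <= remainder_bound m (Cmod z) s.
Proof.
intros Hf Hm Hz Hr Hs Hsm.
assert (H0 : z <> 0%C) by (apply Cmod_gt_0; lra).
destruct (euler_remainder_converges m z s Hm Hz H0 Hs Hsm) as [l [Hl Hb]].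
assert (E := lnGamma_log_gauss f Hf z _ Hz Hr (log_gauss_limit z m l Hz Hl)).
unfold R_hat. rewrite E. replace (m + 1 - 1)%nat with m by lia.
unfold stirling_main.
match goal with |- Cmod ?e <= _ => replace e with l by ring end.
exact Hb.
Qed.

Lemma R_hat_succ f j z :
  (1 <= j)%nat -> R_hat f j z = (T_hat j z + R_hat f (j + 1) z)%C.
Proof.
intros Hj. unfold R_hat. destruct j as [|p]; [lia|].
replace (S p + 1 - 1)%nat with (S p) by lia. replace (S p - 1)%nat with p by lia.
rewrite sum_n_m_T_hat_S. ring.
Qed.

(** What [Cmod (T_hat j z)] becomes, at [Cmod z = r], when the alternating series
    in [bern_half_fourier] is replaced by its first term. *)
Definition T_hat_leading (j : nat) (r : R) : R :=
  2 * INR (fact (2 * j - 2)) / ((2 * PI) ^ (2 * j) * r ^ (2 * j - 1)).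

Lemma T_hat_leading_pos j r : 0 < r -> 0 < T_hat_leading j r.
Proof.
intros Hr. pose proof PI_RGT_0. unfold T_hat_leading.
apply Rdiv_lt_0_compat.
- apply Rmult_lt_0_compat; [lra|apply fact_pos].
- apply Rmult_lt_0_compat; apply pow_lt; lra.
Qed.

Lemma T_hat_leading_succ j r :
  (1 <= j)%nat -> 0 < r ->
  T_hat_leading (S j) r
  = T_hat_leading j r * (INR j * (2 * INR j - 1) / (2 * r ^ 2) / PI ^ 2).
Proof.
intros Hj Hr. pose proof PI_RGT_0. unfold T_hat_leading.
destruct j as [|p]; [lia|].
replace (2 * S (S p) - 2)%nat with (S (S (2 * p))) by lia.
replace (2 * S p - 2)%nat with (2 * p)%nat by lia.
replace (2 * S (S p) - 1)%nat with (2 + (2 * S p - 1))%nat by lia.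
replace (2 * S (S p))%nat with (2 + 2 * S p)%nat by lia.
rewrite !fact_simpl, !mult_INR, !pow_add.
replace (INR (S (S (2 * p)))) with (2 * INR (S p)) by (rewrite !S_INR, mult_INR; simpl; ring).
replace (INR (S (2 * p))) with (2 * INR (S p) - 1) by (rewrite !S_INR, mult_INR; simpl; ring).
assert ((2 * PI) ^ (2 * S p) <> 0) by (apply pow_nonzero; lra).
assert (r ^ (2 * S p - 1) <> 0) by (apply pow_nonzero; lra).
set (a := (2 * PI) ^ (2 * S p)) in *. set (b := r ^ (2 * S p - 1)) in *.
field. repeat split; try assumption; lra.
Qed.

Lemma Cmod_T_hat_bounds j (z : C) :
  (1 <= j)%nat -> z <> 0%C ->
  (1 - (1 / 4) ^ j) * T_hat_leading j (Cmod z) <= Cmod (T_hat j z)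
    <= T_hat_leading j (Cmod z).
Proof.
intros Hj Hz. rewrite Cmod_T_hat by assumption.
assert (Hr : 0 < Cmod z) by (now apply Cmod_gt_0).
pose proof PI_RGT_0. pose proof (fact_pos (2 * j - 2)) as Hf.
destruct (bern_half_abs j Hj) as [H1 H2].
assert (Hp : 0 < (2 * PI) ^ (2 * j)) by (apply pow_lt; lra).
assert (Hq : 0 < Cmod z ^ (2 * j - 1)) by (apply pow_lt; lra).
unfold T_hat_leading.
set (F := INR (fact (2 * j - 2))) in *. set (p := (2 * PI) ^ (2 * j)) in *.
set (q := Cmod z ^ (2 * j - 1)) in *. set (b := Rabs _) in *.
assert (Hfq : 0 <= F / q) by (apply Rlt_le, Rdiv_lt_0_compat; lra).
split.
- replace ((1 - (1 / 4) ^ j) * (2 * F / (p * q))) with (2 * (1 - (1 / 4) ^ j) / p * (F / q))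
    by (field; lra).
  replace (b * F / q) with (b * (F / q)) by (field; lra).
  now apply Rmult_le_compat_r.
- replace (2 * F / (p * q)) with (2 / p * (F / q)) by (field; lra).
  replace (b * F / q) with (b * (F / q)) by (field; lra).
  now apply Rmult_le_compat_r.
Qed.

Lemma remainder_bound_leading m r s :
  (1 <= m)%nat -> 0 < r -> 0 < s ->
  remainder_bound m r s
  <= T_hat_leading m r * (eta m * (2 * INR m - 1) * PI / (2 * s)).
Proof.
intros Hm Hr Hs. unfold remainder_bound, T_hat_leading.
pose proof PI_RGT_0. pose proof (fact_pos (2 * m - 2)) as Hf.
destruct (bern_half_abs m Hm) as [_ H2].
assert (Hp : 0 < (2 * PI) ^ (2 * m)) by (apply pow_lt; lra).
assert (Hq : 0 < r ^ (2 * m - 1)) by (apply pow_lt; lra).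
pose proof (eta_ge_1 m Hm) as He.
replace (2 * m - 1)%nat with (S (2 * m - 2)) at 1 by lia.
rewrite fact_simpl, mult_INR.
replace (INR (S (2 * m - 2))) with (2 * INR m - 1)
  by (replace (S (2 * m - 2)) with (2 * m - 1)%nat by lia;
      rewrite minus_INR, mult_INR by lia; simpl; ring).
assert (HM : 1 <= INR m) by (change 1 with (INR 1); now apply le_INR).
set (F := INR (fact (2 * m - 2))) in *. set (p := (2 * PI) ^ (2 * m)) in *.
set (q := r ^ (2 * m - 1)) in *. set (b := Rabs _) in *.
set (X := eta m * ((2 * INR m - 1) * F / (q * s) * (PI / 2))).
assert (HX : 0 <= X).
{ unfold X. apply Rmult_le_pos; [lra|]. apply Rmult_le_pos; [|lra].
  apply Rmult_le_pos; [apply Rmult_le_pos; lra|].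
  apply Rlt_le, Rinv_0_lt_compat, Rmult_lt_0_compat; lra. }
replace (eta m * b * ((2 * INR m - 1) * F / (q * s) * (PI / 2))) with (b * X)
  by (unfold X; ring).
replace (2 * F / (p * q) * (eta m * (2 * INR m - 1) * PI / (2 * s))) with (2 / p * X)
  by (unfold X; field; lra).
now apply Rmult_le_compat_r.
Qed.

Theorem theorem4 (lnGamma : C -> C) (HlnGamma : is_lnGamma lnGamma)
  (k : nat) (hk : (1 <= k)%nat)
  (z : C) (hRe : 0 <= Re z) (hz : z <> RtoC 0) (hkz : INR k <= Cmod z) :
  Cmod (R_hat lnGamma (k + 1) z / T_hat k z)%C
    < eta k * ((INR k / Cmod z) ^ 2 / (PI ^ 2 - 1))
  /\
  Cmod (R_hat lnGamma k z / T_hat k z)%C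
    < 1 + eta k * ((INR k / Cmod z) ^ 2 / (PI ^ 2 - 1)).
Proof.
assert (HK : 1 <= INR k) by (change 1 with (INR 1); now apply le_INR).
set (r := Cmod z) in *.
assert (Hr : 1 <= r) by lra.
set (Q := fun j => Cmod (R_hat lnGamma (j + 1) z) / T_hat_leading j r).
assert (Ht : forall j, 0 < T_hat_leading j r)
  by (intros j; apply T_hat_leading_pos; lra).
assert (HQ0 : forall j, 0 <= Q j).
{ intros j. apply Rmult_le_pos; [apply Cmod_ge_0|].
  apply Rlt_le, Rinv_0_lt_compat, Ht. }
assert (Hstep : forall j, (1 <= j)%nat ->
  Q j <= INR j * (2 * INR j - 1) / (2 * r ^ 2) / PI ^ 2 * (1 + Q (S j))).
{ intros j Hj. unfold Q at 1. apply Rle_div_l; [apply Ht|].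
  rewrite R_hat_succ by lia. eapply Rle_trans; [apply Cmod_triangle|].
  replace (j + 1)%nat with (S j) by lia.
  apply Rle_trans with (T_hat_leading (S j) r * (1 + Q (S j))).
  - rewrite Rmult_plus_distr_l, Rmult_1_r. apply Rplus_le_compat.
    + apply Cmod_T_hat_bounds; [lia|exact hz].
    + apply Req_le. unfold Q. field. apply Rgt_not_eq, Ht.
  - apply Req_le. rewrite T_hat_leading_succ by (trivial; lra). ring. }
assert (HP : 0 < PI ^ 2 - 1) by (pose proof PI_sqr_bounds; lra).
assert (Hratio : forall j, INR j * (2 * INR j - 1) / (2 * r ^ 2) / PI ^ 2
                           = (INR k / r) ^ 2 * ratio k j).
{ intros j. unfold ratio. field. pose proof PI_RGT_0. lra. }
assert (Hkr : 0 < (INR k / r) ^ 2 <= 1).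
{ assert (0 < INR k / r <= 1); [|nra]. split.
  - apply Rdiv_lt_0_compat; lra.
  - apply Rle_div_l; lra. }
assert (Hrat : forall j, (1 <= j)%nat -> 0 <= ratio k j).
{ intros j Hj. apply le_INR in Hj. simpl (INR 1) in Hj. unfold ratio.
  pose proof (pow_lt (INR k) 2 ltac:(lra)).
  repeat apply Rmult_le_pos; try lra; apply Rlt_le, Rinv_0_lt_compat; lra. }
assert (Hmain : ratio k k * (1 + Q (S k)) < (1 - (1 / 4) ^ k) * eta k / (PI ^ 2 - 1)).
{ apply tail_bound; trivial.
  - intros j Hj. eapply Rle_trans; [apply Hstep; lia|]. rewrite Hratio.
    pose proof (Hrat j ltac:(lia)). pose proof (HQ0 (S j)).
    apply Rmult_le_compat_r; [lra|]. nra.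
  - intros m s Hm Hs Hsm. unfold Q. apply Rle_div_l; [apply Ht|].
    eapply Rle_trans; [apply (R_hat_bound lnGamma m z s); trivial; try lia|].
    rewrite (Rmult_comm _ (T_hat_leading m r)).
    apply remainder_bound_leading; [lia|lra|exact Hs]. }
destruct (Cmod_T_hat_bounds k z hk hz) as [HT _]. fold r in HT.
pose proof (pow_half_le k hk) as Hq.
assert (HTpos : 0 < Cmod (T_hat k z)).
{ eapply Rlt_le_trans; [|exact HT]. apply Rmult_lt_0_compat; [lra|apply Ht]. }
assert (HT0 : T_hat k z <> 0%C) by (now apply Cmod_gt_0).
assert (H1 : Cmod (R_hat lnGamma (k + 1) z / T_hat k z)%C
             < eta k * ((INR k / r) ^ 2 / (PI ^ 2 - 1))).
{ rewrite Cmod_div by exact HT0.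
  apply Rlt_div_l; [exact HTpos|].
  pose proof (eta_ge_1 k hk) as He.
  set (g := (INR k / r) ^ 2) in *. set (a := (1 / 4) ^ k) in *.
  assert (HQk : Q k < g * ((1 - a) * eta k / (PI ^ 2 - 1))).
  { eapply Rle_lt_trans; [apply (Hstep k hk)|]. rewrite Hratio, Rmult_assoc.
    apply Rmult_lt_compat_l; [lra|exact Hmain]. }
  apply Rlt_le_trans with (g * ((1 - a) * eta k / (PI ^ 2 - 1)) * T_hat_leading k r).
  - apply Rlt_div_l; [apply Ht|exact HQk].
  - replace (g * ((1 - a) * eta k / (PI ^ 2 - 1)) * T_hat_leading k r)
      with (eta k * (g / (PI ^ 2 - 1)) * ((1 - a) * T_hat_leading k r)) by (field; lra).
    apply Rmult_le_compat_l; [|exact HT].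
    apply Rmult_le_pos; [lra|]. apply Rlt_le, Rdiv_lt_0_compat; lra. }
split; [exact H1|].
rewrite R_hat_succ by exact hk.
replace ((T_hat k z + R_hat lnGamma (k + 1) z) / T_hat k z)%C
  with (1 + R_hat lnGamma (k + 1) z / T_hat k z)%C by (field; exact HT0).
eapply Rle_lt_trans; [apply Cmod_triangle|]. rewrite Cmod_1. lra.
Qed.
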